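(* For fixed $a\in\mathbb{R}$, the Korteweg--de Vries equation $$u_t=-3uu_x+a\,u_{xxx}$$ for smooth $u:I\times\mathbb{S}^1\to\mathbb{R}$ is the magnetic Euler--Arnold equation of the magnetic system $(\mathrm{Diff}(\mathbb{S}^1),\mathcal{G}^{L^2},a\cdot c_{\mathrm{GF}})$. In particular, a curve $\gamma$ is a magnetic geodesic in $(\mathrm{Diff}(\mathbb{S}^1),\mathcal{G}^{L^2},c_{\mathrm{GF}})$ of strength $a$ if and only if $(u,a)$ with $u:=\dot\gamma\circ\gamma^{-1}$ is a solution of this equation.
   Context: $\mathbb{S}^1=\mathbb{R}/\mathbb{Z}$, $I=[0,T)$. $\mathrm{Diff}(\mathbb{S}^1)$ is the group of smooth diffeomorphisms of $\mathbb{S}^1$, with $T_{\mathrm{id}}\mathrm{Diff}(\mathbb{S}^1)=\mathfrak{X}(\mathbb{S}^1)$ identified with $C^\infty(\mathbb{S}^1)$. $\mathcal{G}^{L^2}$ is the right-invariant Riemannian metric with $\mathcal{G}^{L^2}_{\mathrm{id}}(u,v)=\int_{\mathbb{S}^1}uv\,dx$. The Gelfand--Fuchs cocycle $c_{\mathrm{GF}}(u,v)=\int_{\mathbb{S}^1}u\,v_{xxx}\,dx$ is regarded as a right-invariant closed two-form on $\mathrm{Diff}(\mathbb{S}^1)$. For a Lie group $G$ with right-invariant metric $\mathcal{G}$ and right-invariant closed two-form $\sigma$ (a magnetic system $(G,\mathcal G,\sigma)$), the Lorentz force $Y:TG\to TG$ is defined by $\mathcal{G}_q(Y_qu,v)=\sigma_q(u,v)$,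 and a smooth curve $\gamma$ is a magnetic geodesic of strength $s$ if $\nabla_{\dot\gamma}\dot\gamma=s\,Y_\gamma\dot\gamma$, with $\nabla$ the Levi-Civita connection of $\mathcal{G}$ (strength $1$ if unspecified). The magnetic Euler--Arnold equation is the evolution equation on $\mathfrak g=T_{\mathrm{id}}G$ satisfied by the Eulerian velocity $u=\dot\gamma\circ\gamma^{-1}$ of a magnetic geodesic $\gamma$.
   Formalization: With G(Yu,v)=σ(u,v) and c_GF=∫u v_xxx, the Lorentz force is −u_xxx, so the displayed sign is wrong for a≠0; the theorem proved uses the two-form −a·c_GF (and strength −a for c_GF) for the equation u_t=−3uu_x+a u_xxx. *)

(* Defs.v *)
(* Stdlib real numbers with Coquelicot. *)
From Stdlib Require Import Reals.
From Coquelicot Require Import Coquelicot.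
Open Scope R_scope.

(** * The circle R/Z

    Functions on the circle are 1-periodic functions on R; maps of the circle
    to itself are represented by their lifts R -> R, where [d] below is the
    degree. *)

Definition smooth (f : R -> R) : Prop := forall n x, ex_derive_n f n x.

Definition periodic (f : R -> R) : Prop := forall x, f (x + 1) = f x.

Definition smooth_circle_function (u : R -> R) : Prop := smooth u /\ periodic u.

Definition smooth_circle_map (f : R -> R) : Prop :=
  smooth f /\ exists d : Z, forall x, f (x + 1) = f x + IZR d.

(** Both orientations are allowed: the degree of a diffeomorphism is 1 or -1. *)
Record DiffS1 := {
  lift :> R -> R;
  lift_inv : R -> R;
  lift_smooth : smooth_circle_map lift;
  lift_inv_smooth : smooth_circle_map lift_inv;
  lift_invK : forall x, lift (lift_inv x) = x;
  liftK : forall x, lift_inv (lift x) = x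
}.

(** * Smooth curves

    Smoothness in time and space is joint: a curve in the Frechet manifold
    Diff(S^1), or in C^oo(S^1), is smooth iff the associated function of two
    variables is.  [J] is always an open set of times. *)

Definition jointly_smooth (J : R -> Prop) (f : R -> R -> R) : Prop :=
  forall t x n, J t -> ex_diff_n f n t x.

Definition smooth_curve (J : R -> Prop) (c : R -> DiffS1) : Prop :=
  jointly_smooth J (fun t x => c t x).

(** A curve in C^oo(S^1); since every tangent space of Diff(S^1) is C^oo(S^1)
    (see below), also a vector field along a curve of diffeomorphisms. *)
Definition smooth_field (J : R -> Prop) (X : R -> R -> R) : Prop :=
  jointly_smooth J X /\ forall t, J t -> periodic (X t).

Definition all_times (t : R) : Prop := True.

(** Times range over I = [0,T) with 0 < T <= +oo.  Smoothness on I is smoothness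
    on some open neighbourhood (-d,T) of I, so that derivatives at time 0 are
    the one-sided ones. *)
Definition in_I (T : Rbar) (t : R) : Prop := 0 <= t /\ Rbar_lt t T.

Definition near_I (T : Rbar) (P : (R -> Prop) -> Prop) : Prop :=
  exists d : R, 0 < d /\ P (fun t => - d < t /\ Rbar_lt t T).

(** * Right-invariant structures on Diff(S^1)

    The tangent space at [phi] consists of the vector fields along [phi], that
    is, since T S^1 is trivial, of functions X in C^oo(S^1); right translation
    to the identity is X |-> X o phi^-1. *)

Definition right_invariant (B : (R -> R) -> (R -> R) -> R)
    (phi : DiffS1) (X Z : R -> R) : R :=
  B (fun x => X (lift_inv phi x)) (fun x => Z (lift_inv phi x)).

Definition bilinear (B : (R -> R) -> (R -> R) -> R) : Prop :=
  (forall a b u v w,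
     smooth_circle_function u -> smooth_circle_function v ->
     smooth_circle_function w ->
     B (fun x => a * u x + b * v x) w = a * B u w + b * B v w) /\
  (forall a b u v w,
     smooth_circle_function u -> smooth_circle_function v ->
     smooth_circle_function w ->
     B w (fun x => a * u x + b * v x) = a * B w u + b * B w v).

Definition inner_product (g : (R -> R) -> (R -> R) -> R) : Prop :=
  bilinear g /\
  (forall u v, smooth_circle_function u -> smooth_circle_function v ->
     g u v = g v u) /\
  (forall u, smooth_circle_function u -> (exists x, u x <> 0) -> 0 < g u u).

Definition bracket (u v : R -> R) : R -> R :=
  fun x => u x * Derive v x - Derive u x * v x.

(** The right-invariant two-form with value [c] at the identity is closed iff
    [c] is a cocycle of the Lie algebra of vector fields. *)
Definition two_cocycle (c : (R -> R) -> (R -> R) -> R) : Prop :=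
  bilinear c /\
  (forall u v, smooth_circle_function u -> smooth_circle_function v ->
     c u v = - c v u) /\
  (forall u v w, smooth_circle_function u -> smooth_circle_function v ->
     smooth_circle_function w ->
     c (bracket u v) w + c (bracket v w) u + c (bracket w u) v = 0).

(** A magnetic system on Diff(S^1), given by the values at the identity of its
    right-invariant metric and of its right-invariant closed two-form. *)
Definition magnetic_system (g s : (R -> R) -> (R -> R) -> R) : Prop :=
  inner_product g /\ two_cocycle s.

(** * The Levi-Civita connection

    Translating lifts identifies Diff(S^1) locally with open subsets of
    C^oo(S^1), with translations as transition maps.  So a connection is
    d + Gamma for a globally defined Christoffel symbol Gamma, bilinear on each
    tangent space and taking smooth curves to smooth curves.  Vector fields on
    Diff(S^1) have bracket D eta [xi] - D xi [eta], so the torsion is the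
    antisymmetrization of Gamma. *)

Definition christoffel : Type := DiffS1 -> (R -> R) -> (R -> R) -> R -> R.

Definition connection (Gamma : christoffel) : Prop :=
  (forall phi X Z, smooth_circle_function X -> smooth_circle_function Z ->
     smooth_circle_function (Gamma phi X Z)) /\
  (forall phi x, bilinear (fun X Z => Gamma phi X Z x)) /\
  (forall c X Z, smooth_curve all_times c ->
     smooth_field all_times X -> smooth_field all_times Z ->
     smooth_field all_times (fun t => Gamma (c t) (X t) (Z t))).

Definition velocity (c : R -> DiffS1) (t : R) : R -> R :=
  fun x => Derive (fun r => c r x) t.

(** The covariant derivative at time [t] of a vector field [X] along [c]. *)
Definition cov_deriv (Gamma : christoffel) (c : R -> DiffS1)
    (X : R -> R -> R) (t : R) : R -> R :=
  fun x => Derive (fun r => X r x) t + Gamma (c t) (velocity c t) (X t) x.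

Definition torsion_free (Gamma : christoffel) : Prop :=
  forall phi X Z x, smooth_circle_function X -> smooth_circle_function Z ->
    Gamma phi X Z x = Gamma phi Z X x.

Definition metric_compatible (G : DiffS1 -> (R -> R) -> (R -> R) -> R)
    (Gamma : christoffel) : Prop :=
  forall c X Z, smooth_curve all_times c ->
    smooth_field all_times X -> smooth_field all_times Z ->
    forall t, is_derive (fun r => G (c r) (X r) (Z r)) t
      (G (c t) (cov_deriv Gamma c X t) (Z t) +
       G (c t) (X t) (cov_deriv Gamma c Z t)).

Definition levi_civita (G : DiffS1 -> (R -> R) -> (R -> R) -> R)
    (Gamma : christoffel) : Prop :=
  connection Gamma /\ torsion_free Gamma /\ metric_compatible G Gamma.

(** * Magnetic geodesics *)

Definition lorentz_force (G S : DiffS1 -> (R -> R) -> (R -> R) -> R)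
    (Y : DiffS1 -> (R -> R) -> R -> R) : Prop :=
  forall phi X, smooth_circle_function X ->
    smooth_circle_function (Y phi X) /\
    forall Z, smooth_circle_function Z -> G phi (Y phi X) Z = S phi X Z.

(** [Gamma] and [Y] need not exist for a weak Riemannian metric, but are unique
    if they do. *)
Definition magnetic_geodesic (g s : (R -> R) -> (R -> R) -> R) (strength : R)
    (T : Rbar) (gamma : R -> DiffS1) : Prop :=
  near_I T (fun J => smooth_curve J gamma) /\
  exists Gamma Y,
    levi_civita (right_invariant g) Gamma /\
    lorentz_force (right_invariant g) (right_invariant s) Y /\
    forall t x, in_I T t ->
      cov_deriv Gamma gamma (velocity gamma) t x =
      strength * Y (gamma t) (velocity gamma t) x.

Definition eulerian_velocity (gamma : R -> DiffS1) (t : R) : R -> R :=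
  fun x => velocity gamma t (lift_inv (gamma t) x).

(** Smooth solutions on I of the evolution equation u_t = F(u) on C^oo(S^1). *)
Definition evolution_solution (F : (R -> R) -> R -> R) (T : Rbar)
    (u : R -> R -> R) : Prop :=
  near_I T (fun J => smooth_field J u) /\
  forall t x, in_I T t -> Derive (fun r => u r x) t = F (u t) x.

(** u_t = F(u) is the magnetic Euler-Arnold equation of the system (g,s). *)
Definition magnetic_euler_arnold (g s : (R -> R) -> (R -> R) -> R)
    (F : (R -> R) -> R -> R) : Prop :=
  magnetic_system g s /\
  forall (T : Rbar) (gamma : R -> DiffS1),
    Rbar_lt 0 T -> near_I T (fun J => smooth_curve J gamma) ->
    (magnetic_geodesic g s 1 T gamma <->
     evolution_solution F T (eulerian_velocity gamma)).

(** * The L^2 metric, the Gelfand-Fuchs cocycle and the KdV equation *)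

Definition L2 (u v : R -> R) : R := RInt (fun x => u x * v x) 0 1.

Definition gelfand_fuchs (u v : R -> R) : R :=
  RInt (fun x => u x * Derive_n v 3 x) 0 1.

(** The right-hand side of u_t = -3 u u_x + a u_xxx. *)
Definition KdV (a : R) (u : R -> R) : R -> R :=
  fun x => -3 * u x * Derive u x + a * Derive_n u 3 x.

(* Main.v *)
Require Import Defs.
From Stdlib Require Import Reals ZArith Lra Lia FunctionalExtensionality.
From Coquelicot Require Import Coquelicot.
Open Scope R_scope.

(** Let V be the velocity of a curve phi_t of diffeomorphisms and u = V o phi^-1.
    The Levi-Civita connection of the right-invariant L^2 metric has Christoffel
    symbol Gamma_phi(X, Z) = (X Z)' / phi', so that the covariant acceleration is
    (u_t + 3 u u_x) o phi, while the Lorentz force of k c_GF is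
    - k u_xxx o phi by integration by parts.

    Metric compatibility is checked on the circle after right translation: the
    derivative of the metric and the expected expression differ by the integral
    of the divergence of 2 (V X Z) o phi^-1.  Uniqueness of the connection is the
    Koszul argument, applied to constant fields along the curves
    phi + t / (1 + t^2) eps V, which consist of diffeomorphisms for small eps.
    Both steps rest on the joint smoothness of (t, x) |-> phi_t^-1(x). *)

(** * Functions of time and space *)

Lemma is_derive_cst (c x : R) : is_derive (fun _ : R => c) x 0.
Proof. exact (is_derive_const (V := R_NormedModule) c x). Qed.

Lemma is_derive_var (x : R) : is_derive (fun y : R => y) x 1.
Proof. exact (is_derive_id (K := R_AbsRing) x). Qed.

Lemma Derive_n_Derive (f : R -> R) n x : Derive_n (Derive f) n x = Derive_n f (S n) x.
Proof. rewrite <- Nat.add_1_r. exact (Derive_n_comp f n 1 x). Qed.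

(** The shift starts at order one on the left, because [ex_derive_n] is trivially true at order
    zero. *)
Lemma ex_derive_n_Derive (f : R -> R) n x :
  ex_derive_n (Derive f) (S n) x <-> ex_derive_n f (S (S n)) x.
Proof.
  split; apply ex_derive_ext; intros y; [|symmetry]; apply Derive_n_Derive.
Qed.

Definition dt (f : R -> R -> R) (t x : R) : R := Derive (fun s => f s x) t.
Definition dx (f : R -> R -> R) (t x : R) : R := Derive (fun y => f t y) x.

(** A finite-order form of joint smoothness, so that closure properties can be proved by induction
    on the order. *)
Definition Ck (J : R -> Prop) (n : nat) (f : R -> R -> R) : Prop :=
  forall t x, J t -> ex_diff_n f n t x.

Lemma open_locally_2d (J : R -> Prop) (P : R -> R -> Prop) t x :
  open J -> J t -> (forall s y, J s -> P s y) -> locally_2d P t x.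
Proof.
  intros HJ Ht HP. destruct (HJ t Ht) as [d Hd].
  exists d. intros s y Hs _. apply HP, Hd, Hs.
Qed.

Lemma Ck_ext (J : R -> Prop) n f g :
  open J -> (forall t x, J t -> f t x = g t x) -> Ck J n f -> Ck J n g.
Proof.
  intros HJ Hfg Hf t x Ht.
  apply (ex_diff_n_ext_loc f g); [|exact (Hf t x Ht)].
  exact (open_locally_2d J (fun s y => f s y = g s y) t x HJ Ht Hfg).
Qed.

Lemma Ck_le (J : R -> Prop) n m f : (m <= n)%nat -> Ck J n f -> Ck J m f.
Proof. intros Hmn Hf t x Ht. exact (ex_diff_n_m n m Hmn f t x (Hf t x Ht)). Qed.

Lemma Ck_continuity (J : R -> Prop) n f t x :
  Ck J n f -> J t -> continuity_2d_pt f t x.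
Proof. intros Hf Ht. specialize (Hf t x Ht). destruct n; exact (proj1 Hf). Qed.

(** Total differentiability from partials: the time partial exists nearby and is continuous at the
    point, the space partial exists at the point alone. *)
Lemma differentiable_of_partials (J : R -> Prop) (f ft : R -> R -> R) t x l :
  open J -> J t ->
  (forall s y, J s -> is_derive (fun r => f r y) s (ft s y)) ->
  is_derive (fun y => f t y) x l ->
  continuity_2d_pt ft t x ->
  differentiable_pt_lim f t x (ft t x) l.
Proof.
  intros HJ Ht Hft Hl Hc.
  apply (proj1 (filterdiff_differentiable_pt_lim f t x (ft t x) l)).
  apply (is_derive_filterdiff f t x ft l).
  - apply (proj1 (locally_2d_locally
      (fun s y => is_derive (fun z => f z y) s (ft s y)) t x)).
    exact (open_locally_2d J _ t x HJ Ht Hft).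
  - exact Hl.
  - exact (proj1 (continuity_2d_pt_filterlim ft t x) Hc).
Qed.

(** The induction step of all closure proofs below: it suffices to exhibit explicit partials [ft]
    and [fx] that are regular of order [n]. *)
Lemma Ck_S (J : R -> Prop) n (f ft fx : R -> R -> R) :
  open J ->
  (forall t x, J t -> is_derive (fun s => f s x) t (ft t x)) ->
  (forall t x, J t -> is_derive (fun y => f t y) x (fx t x)) ->
  Ck J n ft -> Ck J n fx -> Ck J (S n) f.
Proof.
  intros HJ Ht Hx Cft Cfx t x HJt. simpl.
  split; [|split; [|split; [|split]]].
  - apply differentiable_continuity_pt. exists (ft t x), (fx t x).
    apply (differentiable_of_partials J); auto.
    exact (Ck_continuity J n ft t x Cft HJt).
  - eexists. exact (Ht t x HJt).
  - eexists. exact (Hx t x HJt).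
  - revert t x HJt. apply (Ck_ext J n ft); auto.
    intros t x HJt. symmetry. apply is_derive_unique. auto.
  - revert t x HJt. apply (Ck_ext J n fx); auto.
    intros t x HJt. symmetry. apply is_derive_unique. auto.
Qed.

Lemma Ck_derivatives (J : R -> Prop) n f : Ck J (S n) f ->
  (forall t x, J t -> is_derive (fun s => f s x) t (dt f t x)) /\
  (forall t x, J t -> is_derive (fun y => f t y) x (dx f t x)) /\
  Ck J n (dt f) /\ Ck J n (dx f).
Proof.
  intros Hf.
  split; [|split; [|split]]; intros t x Ht;
    destruct (Hf t x Ht) as (_ & H1 & H2 & H3 & H4).
  - apply Derive_correct. exact H1.
  - apply Derive_correct. exact H2.
  - exact H3.
  - exact H4.
Qed.

Lemma Ck_const (J : R -> Prop) n c : open J -> Ck J n (fun _ _ => c).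
Proof.
  intros HJ. revert c. induction n as [|n IH]; intros c.
  - intros t x _. split; [apply continuity_2d_pt_const|exact I].
  - apply (Ck_S J n _ (fun _ _ => 0) (fun _ _ => 0)); auto;
      intros; apply is_derive_cst.
Qed.

Lemma Ck_snd (J : R -> Prop) n : open J -> Ck J n (fun _ x => x).
Proof.
  intros HJ. destruct n as [|n].
  - intros t x _. split; [apply continuity_2d_pt_id2|exact I].
  - apply (Ck_S J n _ (fun _ _ => 0) (fun _ _ => 1)); auto using Ck_const.
    + intros. apply is_derive_cst.
    + intros. apply is_derive_var.
Qed.

Lemma Ck_fst (J : R -> Prop) n : open J -> Ck J n (fun t _ => t).
Proof.
  intros HJ. destruct n as [|n].
  - intros t x _. split; [apply continuity_2d_pt_id1|exact I].
  - apply (Ck_S J n _ (fun _ _ => 1) (fun _ _ => 0)); auto using Ck_const.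
    + intros. apply is_derive_var.
    + intros. apply is_derive_cst.
Qed.

Lemma Ck_plus (J : R -> Prop) n f g :
  open J -> Ck J n f -> Ck J n g -> Ck J n (fun t x => f t x + g t x).
Proof.
  intros HJ. revert f g. induction n as [|n IH]; intros f g Hf Hg.
  - intros t x Ht. split; [|exact I].
    apply continuity_2d_pt_plus; eapply Ck_continuity; eauto.
  - destruct (Ck_derivatives J n f Hf) as (f1 & f2 & f3 & f4).
    destruct (Ck_derivatives J n g Hg) as (g1 & g2 & g3 & g4).
    apply (Ck_S J n _ (fun t x => dt f t x + dt g t x)
                      (fun t x => dx f t x + dx g t x)); auto;
      intros t x Ht.
    + exact (is_derive_plus _ _ _ _ _ (f1 t x Ht) (g1 t x Ht)).
    + exact (is_derive_plus _ _ _ _ _ (f2 t x Ht) (g2 t x Ht)).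
Qed.

Lemma Ck_mult (J : R -> Prop) n f g :
  open J -> Ck J n f -> Ck J n g -> Ck J n (fun t x => f t x * g t x).
Proof.
  intros HJ. revert f g. induction n as [|n IH]; intros f g Hf Hg.
  - intros t x Ht. split; [|exact I].
    apply continuity_2d_pt_mult; eapply Ck_continuity; eauto.
  - destruct (Ck_derivatives J n f Hf) as (f1 & f2 & f3 & f4).
    destruct (Ck_derivatives J n g Hg) as (g1 & g2 & g3 & g4).
    assert (f0 : Ck J n f) by (apply (Ck_le J (S n)); auto).
    assert (g0 : Ck J n g) by (apply (Ck_le J (S n)); auto).
    apply (Ck_S J n _ (fun t x => dt f t x * g t x + f t x * dt g t x)
                      (fun t x => dx f t x * g t x + f t x * dx g t x));
      auto using Ck_plus; intros t x Ht.
    + exact (is_derive_mult _ _ _ _ _ (f1 t x Ht) (g1 t x Ht) Rmult_comm).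
    + exact (is_derive_mult _ _ _ _ _ (f2 t x Ht) (g2 t x Ht) Rmult_comm).
Qed.

Lemma Ck_inv (J : R -> Prop) n f :
  open J -> (forall t x, J t -> f t x <> 0) -> Ck J n f ->
  Ck J n (fun t x => / f t x).
Proof.
  intros HJ Hnz. induction n as [|n IH]; intros Hf.
  - intros t x Ht. split; [|exact I].
    apply continuity_2d_pt_inv; auto. eapply Ck_continuity; eauto.
  - destruct (Ck_derivatives J n f Hf) as (f1 & f2 & f3 & f4).
    assert (f0 : Ck J n (fun t x => / f t x))
      by (apply IH, (Ck_le J (S n)); auto).
    (* Both partials of 1 / f have the form - h / f^2 with h a partial of f. Written as products,
       they are covered by [Ck_mult] and the induction hypothesis. *)
    assert (D : forall h, Ck J n h ->
              Ck J n (fun t x => - 1 * h t x * (/ f t x * / f t x))).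
    { intros h Hh. apply Ck_mult; auto.
      - apply Ck_mult; auto. apply Ck_const; auto.
      - apply Ck_mult; auto. }
    apply (Ck_S J n _ (fun t x => - 1 * dt f t x * (/ f t x * / f t x))
                      (fun t x => - 1 * dx f t x * (/ f t x * / f t x)));
      auto; intros t x Ht.
    + replace (-1 * dt f t x * (/ f t x * / f t x)) with (- dt f t x / f t x ^ 2)
        by (field; auto).
      apply (is_derive_inv (fun s => f s x)); auto.
    + replace (-1 * dx f t x * (/ f t x * / f t x)) with (- dx f t x / f t x ^ 2)
        by (field; auto).
      apply (is_derive_inv (fun y => f t y)); auto.
Qed.

(** * Joint smoothness of all orders and the chain rule *)

Section JointSmoothness.

Variable J : R -> Prop.
Hypothesis HJ : open J.

Notation js := (jointly_smooth J).

Lemma js_Ck f : js f <-> forall n, Ck J n f.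
Proof. split; intros H; [intros n t x Ht | intros t x n Ht]; apply H; auto. Qed.

Lemma js_derivatives f : js f ->
  (forall t x, J t -> is_derive (fun s => f s x) t (dt f t x)) /\
  (forall t x, J t -> is_derive (fun y => f t y) x (dx f t x)).
Proof.
  intros Hf. destruct (Ck_derivatives J 0 f) as (H1 & H2 & _); auto.
  apply js_Ck; auto.
Qed.

Lemma js_dt f : js f -> js (dt f).
Proof.
  intros Hf. apply js_Ck. intros n.
  apply Ck_derivatives. apply js_Ck; auto.
Qed.

Lemma js_dx f : js f -> js (dx f).
Proof.
  intros Hf. apply js_Ck. intros n.
  apply Ck_derivatives. apply js_Ck; auto.
Qed.

Lemma js_ext f g : (forall t x, J t -> f t x = g t x) -> js f -> js g.
Proof.
  intros H Hf. apply js_Ck. intros n. apply (Ck_ext J n f); auto.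
  apply js_Ck; auto.
Qed.

Lemma js_const c : js (fun _ _ => c).
Proof. apply js_Ck. intros n. apply Ck_const; auto. Qed.

Lemma js_snd : js (fun _ x => x).
Proof. apply js_Ck. intros n. apply Ck_snd; auto. Qed.

Lemma js_fst : js (fun t _ => t).
Proof. apply js_Ck. intros n. apply Ck_fst; auto. Qed.

Lemma js_plus f g : js f -> js g -> js (fun t x => f t x + g t x).
Proof.
  rewrite !js_Ck. intros Hf Hg n. apply Ck_plus; auto.
Qed.

Lemma js_mult f g : js f -> js g -> js (fun t x => f t x * g t x).
Proof.
  rewrite !js_Ck. intros Hf Hg n. apply Ck_mult; auto.
Qed.

Lemma js_div f g : (forall t x, J t -> g t x <> 0) -> js f -> js g ->
  js (fun t x => f t x / g t x).
Proof.
  rewrite !js_Ck. intros Hnz Hf Hg n. apply Ck_mult; auto. apply Ck_inv; auto.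
Qed.

Lemma js_differentiable f t x : js f -> J t ->
  differentiable_pt_lim f t x (dt f t x) (dx f t x).
Proof.
  intros Hf Ht. destruct (js_derivatives f Hf) as [H1 H2].
  apply (differentiable_of_partials J); auto.
  apply (Ck_continuity J 0); auto. apply js_Ck, js_dt; auto.
Qed.

Lemma chain_t (f b : R -> R -> R) t x l : js f -> J t ->
  is_derive (fun s => b s x) t l ->
  is_derive (fun s => f s (b s x)) t (dt f t (b t x) + dx f t (b t x) * l).
Proof.
  intros Hf Ht Hb. apply is_derive_Reals.
  (* The factor 1 is the derivative of the identity in time, the first inner function. *)
  replace (dt f t (b t x) + dx f t (b t x) * l)
    with (dt f t (b t x) * 1 + dx f t (b t x) * l) by ring.
  apply (derivable_pt_lim_comp_2d f (fun s => s) (fun s => b s x)).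
  - apply js_differentiable; auto.
  - apply derivable_pt_lim_id.
  - apply is_derive_Reals; auto.
Qed.

Lemma chain_x (f b : R -> R -> R) t x l : js f -> J t ->
  is_derive (fun y => b t y) x l ->
  is_derive (fun y => f t (b t y)) x (dx f t (b t x) * l).
Proof.
  intros Hf Ht Hb. rewrite Rmult_comm.
  apply (is_derive_comp (fun y => f t y)); auto.
  apply js_derivatives; auto.
Qed.

(** Smoothness of the outer function passes to [dt f] and [dx f], so the induction runs over all [f]
    at once, while [b] loses one order at each step. *)
Lemma Ck_comp n f b : js f -> Ck J n b -> Ck J n (fun t x => f t (b t x)).
Proof.
  revert f. induction n as [|n IH]; intros f Hf Hb.
  - intros t x Ht. split; [|exact I].
    apply continuity_2d_pt_filterlim.
    apply (filterlim_comp_2 (F := locally (t, x)) (G := locally t)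
             (H := locally (b t x)) (fun z => fst z)
             (fun z => b (fst z) (snd z)) f).
    + apply continuous_fst.
    + apply (proj1 (continuity_2d_pt_filterlim b t x)).
      exact (proj1 (Hb t x Ht)).
    + assert (Hc : continuity_2d_pt f t (b t x))
        by (apply (Ck_continuity J 0); auto; apply js_Ck; auto).
      apply continuity_2d_pt_filterlim in Hc.
      intros P HP. destruct (Hc P HP) as [d Hd].
      exists (ball t d) (ball (b t x) d).
      * exists d; auto.
      * exists d; auto.
      * intros u v Hu Hv. apply (Hd (u, v)). split; auto.
  - destruct (Ck_derivatives J n b Hb) as (b1 & b2 & b3 & b4).
    assert (b0 : Ck J n b) by (apply (Ck_le J (S n)); auto).
    apply (Ck_S J n _ (fun t x => dt f t (b t x) + dx f t (b t x) * dt b t x)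
                      (fun t x => dx f t (b t x) * dx b t x)); auto.
    + intros t x Ht. apply chain_t; auto.
    + intros t x Ht. apply chain_x; auto.
    + apply Ck_plus; [auto| |]. { apply IH; auto using js_dt. }
      apply Ck_mult; auto. apply IH; auto using js_dx.
    + apply Ck_mult; auto. apply IH; auto using js_dx.
Qed.

Lemma js_comp f b : js f -> js b -> js (fun t x => f t (b t x)).
Proof.
  intros Hf Hb. apply js_Ck. intros n. apply Ck_comp; auto. apply js_Ck; auto.
Qed.

Lemma js_slice_smooth f t : js f -> J t -> smooth (f t).
Proof.
  intros Hf Ht n. revert f Hf. induction n as [|n IH]; intros f Hf x; [exact I|].
  destruct n as [|n].
  - eexists. exact (proj2 (js_derivatives f Hf) t x Ht).
  - apply (proj1 (ex_derive_n_Derive (f t) n x)).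
    change (Derive (f t)) with (dx f t). apply IH, js_dx, Hf.
Qed.

Lemma js_of_smooth f : smooth f -> js (fun _ x => f x).
Proof.
  intros Hf. apply js_Ck. intros n. revert f Hf.
  induction n as [|n IH]; intros f Hf.
  - intros t x _. split; [|exact I].
    apply (continuity_1d_2d_pt_comp f (fun _ v => v)).
    + apply continuity_pt_filterlim. apply (ex_derive_continuous f).
      exact (Hf 1%nat x).
    + apply continuity_2d_pt_id2.
  - apply (Ck_S J n _ (fun _ _ => 0) (fun _ x => Derive f x)); auto using Ck_const.
    + intros. apply is_derive_cst.
    + intros. apply Derive_correct. exact (Hf 1%nat x).
    + apply IH. intros [|k] x; [exact I|].
      apply (proj2 (ex_derive_n_Derive f k x)), Hf.
Qed.

End JointSmoothness.

(** * Inverses of families of diffeomorphisms *)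

(** Implicit differentiation starting from mere continuity of [h]: its differentiability is
    extracted from the total differential of [F] at one point. *)
Lemma implicit_derivative (F : R -> R -> R) (h : R -> R) t lt ly :
  differentiable_pt_lim F t (h t) lt ly -> ly <> 0 -> continuous h t ->
  locally t (fun s => F s (h s) = F t (h t)) ->
  is_derive h t (- lt / ly).
Proof.
  intros HF Hly Hc Heq. apply is_derive_Reals. intros eps Heps.
  set (L := - lt / ly).
  assert (Hm : 0 < Rabs ly) by (apply Rabs_pos_lt; auto).
  assert (HL : 0 <= Rabs L) by apply Rabs_pos.
  (* The bound 1/2 allows the increment of [h] to be absorbed on the left; the second bound turns
     the final estimate into [eps]. *)
  set (e := Rmin (1 / 2) (eps / (2 * (2 * Rabs L + 2)))).
  assert (He : 0 < e) by (apply Rmin_glb_lt; [lra|apply Rdiv_lt_0_compat; lra]).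
  destruct (HF (mkposreal (Rabs ly * e) (Rmult_lt_0_compat _ _ Hm He))) as [d1 H1].
  destruct (proj1 (filterlim_locally h (h t)) Hc d1) as [d2 H2].
  destruct Heq as [d3 H3].
  assert (Hd : 0 < Rmin d1 (Rmin d2 d3))
    by (apply Rmin_glb_lt; [apply cond_pos|apply Rmin_glb_lt; apply cond_pos]).
  exists (mkposreal _ Hd). intros k Hk0 Hk. simpl in Hk.
  assert (Hk1 : Rabs k < d1) by (eapply Rlt_le_trans; [exact Hk|apply Rmin_l]).
  assert (Hk23 : Rabs k < Rmin d2 d3)
    by (eapply Rlt_le_trans; [exact Hk|apply Rmin_r]).
  assert (Hk2 : Rabs k < d2) by (eapply Rlt_le_trans; [exact Hk23|apply Rmin_l]).
  assert (Hk3 : Rabs k < d3) by (eapply Rlt_le_trans; [exact Hk23|apply Rmin_r]).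
  assert (Eb : forall d : posreal, Rabs k < d -> ball t d (t + k)).
  { intros d Hkd. unfold ball; simpl. unfold AbsRing_ball, abs, minus, plus, opp; simpl.
    replace (t + k + - t) with k by ring. exact Hkd. }
  specialize (H2 (t + k) (Eb d2 Hk2)). specialize (H3 (t + k) (Eb d3 Hk3)).
  assert (Hb : Rabs (h (t + k) - h t) < d1) by exact H2.
  assert (Ha : Rabs (t + k - t) < d1) by (replace (t + k - t) with k by ring; auto).
  specialize (H1 (t + k) (h (t + k)) Ha Hb). simpl in H1.
  rewrite H3 in H1. replace (t + k - t) with k in H1 by ring.
  set (D := h (t + k) - h t) in *.
  (* Since [F] is constant along the graph of [h], the remainder of its first-order expansion is -
     ly (D - L k). *)
  replace (F t (h t) - F t (h t) - (lt * k + ly * D)) with (- ly * (D - L * k)) in H1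
    by (unfold L; field; auto).
  rewrite Rabs_mult, Rabs_Ropp, Rmult_assoc in H1.
  apply Rmult_le_reg_l in H1; auto.
  assert (Hkp : 0 < Rabs k) by (apply Rabs_pos_lt; auto).
  assert (HDp : 0 <= Rabs D) by apply Rabs_pos.
  assert (HM : Rmax (Rabs k) (Rabs D) <= Rabs k + Rabs D)
    by (apply Rmax_lub; lra).
  assert (Htri : Rabs D <= Rabs (D - L * k) + Rabs L * Rabs k).
  { rewrite <- Rabs_mult.
    replace D with ((D - L * k) + L * k) at 1 by ring. apply Rabs_triang. }
  assert (He1 : e <= 1 / 2) by apply Rmin_l.
  assert (He2 : e * (2 * (2 * Rabs L + 2)) <= eps).
  { apply Rmult_le_reg_r with (/ (2 * (2 * Rabs L + 2))).
    - apply Rinv_0_lt_compat; lra.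
    - rewrite Rmult_assoc, Rinv_r, Rmult_1_r by lra. apply Rmin_r. }
  assert (HDL : Rabs (D - L * k) <= e * (Rabs k + Rabs D))
    by (apply Rle_trans with (1 := H1), Rmult_le_compat_l; lra).
  (* Absorption: |D| is at most |L| |k| + (|k| + |D|) / 2, so the increment of [h] is of order
     |k|. *)
  assert (HD : Rabs D <= (2 * Rabs L + 1) * Rabs k).
  { assert (e * (Rabs k + Rabs D) <= 1 / 2 * (Rabs k + Rabs D))
      by (apply Rmult_le_compat_r; lra). lra. }
  assert (Hfin : Rabs (D - L * k) <= e * (2 * Rabs L + 2) * Rabs k).
  { apply Rle_trans with (1 := HDL). rewrite Rmult_assoc.
    apply Rmult_le_compat_l; lra. }
  replace (D / k - L) with ((D - L * k) / k) by (field; auto).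
  unfold Rdiv. rewrite Rabs_mult, Rabs_inv.
  apply Rmult_lt_reg_r with (Rabs k); auto.
  rewrite Rmult_assoc, Rinv_l, Rmult_1_r by lra.
  apply Rle_lt_trans with (1 := Hfin). apply Rmult_lt_compat_r; auto. nra.
Qed.

Section InverseFamily.

Variables (J : R -> Prop) (f g : R -> R -> R).
Hypothesis HJ : open J.
Hypothesis Hf : jointly_smooth J f.
Hypothesis fg : forall t x, J t -> f t (g t x) = x.
Hypothesis gf : forall t x, J t -> g t (f t x) = x.
Hypothesis f_immersion : forall t x, J t -> dx f t x <> 0.

Lemma slice_continuity t : J t -> continuity (f t).
Proof.
  intros Ht y. apply derivable_continuous_pt.
  exists (dx f t y). apply is_derive_Reals. apply (js_derivatives J f Hf); auto.
Qed.

(** As the derivative at y is nonzero, f_t - x has opposite signs at y - r and y + r. This is an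
    open condition in time and value, and the intermediate value theorem then traps the nearby
    inverses in [y - r, y + r]. *)
Lemma inverse_family_continuity t x : J t -> continuity_2d_pt g t x.
Proof.
  intros Ht eps. set (y := g t x). set (l := dx f t y).
  assert (Hl : l <> 0) by (apply f_immersion; auto).
  assert (Hl2 : 0 < Rabs l / 2) by (apply Rabs_pos_lt in Hl; lra).
  assert (Dl : derivable_pt_lim (f t) y l)
    by (apply is_derive_Reals, (js_derivatives J f Hf); auto).
  destruct (Dl (Rabs l / 2) Hl2) as [d Hd].
  (* Halving keeps [r] strictly below both [d], where the difference quotient is controlled, and the
     target [eps]. *)
  set (r := Rmin d eps / 2).
  assert (Hr : 0 < Rmin d eps) by (apply Rmin_glb_lt; apply cond_pos).
  assert (Hrd : Rmin d eps <= d) by apply Rmin_l.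
  assert (Hre : Rmin d eps <= eps) by apply Rmin_r.
  assert (Hneg : (f t (y + - r) - x) * (f t (y + r) - x) < 0).
  { assert (E : f t y = x) by (apply fg; auto).
    assert (A1 := Hd r). assert (A2 := Hd (- r)).
    rewrite E in A1, A2.
    rewrite Rabs_Ropp in A2.
    rewrite (Rabs_pos_eq r) in A1, A2 by (unfold r; lra).
    specialize (A1 ltac:(unfold r; lra) ltac:(unfold r; lra)).
    specialize (A2 ltac:(unfold r; lra) ltac:(unfold r; lra)).
    set (a := (f t (y + r) - x) / r) in *.
    set (b := (f t (y + - r) - x) / - r) in *.
    assert (Ea : f t (y + r) - x = a * r) by (unfold a; field; unfold r; lra).
    assert (Eb : f t (y + - r) - x = - b * r) by (unfold b; field; unfold r; lra).
    rewrite Ea, Eb.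
    (* Both difference quotients lie within |l| / 2 of l and hence share its sign. *)
    assert (Hab : 0 < a * b).
    { apply Rabs_def2 in A1. apply Rabs_def2 in A2.
      destruct (Rdichotomy _ _ Hl) as [Hn|Hp].
      - rewrite (Rabs_left l) in A1, A2 by lra. nra.
      - rewrite (Rabs_pos_eq l) in A1, A2 by lra. nra. }
    assert (Hrr : 0 < r * r) by (unfold r; nra). nra. }
  assert (Hc : continuity_2d_pt
     (fun s z => (f s (y + - r) + -1 * z) * (f s (y + r) + -1 * z)) t x).
  { apply (Ck_continuity J 0); auto. apply js_Ck.
    assert (Hk : forall c, jointly_smooth J (fun s z => f s c + -1 * z)).
    { intros c. apply js_plus; auto.
      - apply (js_comp J HJ f (fun _ _ => c)); auto. apply js_const; auto.
      - apply js_mult; auto; [apply js_const | apply js_snd]; auto. }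
    apply js_mult; auto. }
  set (P := fun s z : R => (f s (y + - r) + -1 * z) * (f s (y + r) + -1 * z)) in Hc.
  assert (HP : 0 < - P t x) by (unfold P; lra).
  destruct (Hc (mkposreal _ HP)) as [d1 H1]. destruct (HJ t Ht) as [d2 H2].
  assert (Hd12 : 0 < Rmin d1 d2) by (apply Rmin_glb_lt; apply cond_pos).
  exists (mkposreal _ Hd12). simpl. intros s z Hs Hz.
  assert (Js : J s).
  { apply H2. eapply Rlt_le_trans; [exact Hs|apply Rmin_r]. }
  assert (Hs1 : Rabs (s - t) < d1) by (eapply Rlt_le_trans; [exact Hs|apply Rmin_l]).
  assert (Hz1 : Rabs (z - x) < d1) by (eapply Rlt_le_trans; [exact Hz|apply Rmin_l]).
  specialize (H1 s z Hs1 Hz1). simpl in H1. apply Rabs_def2 in H1.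
  (* The product of the two values is still negative at (s, z); the root found is g_s(z), because
     g_s is a left inverse of f_s. *)
  destruct (IVT_cor (fun v => f s v - z) (y + - r) (y + r)) as (v & Hv & Ev).
  - intros v. apply continuity_pt_minus.
    + apply slice_continuity; auto.
    + apply continuity_pt_const. intros ? ?; reflexivity.
  - unfold r; lra.
  - unfold P in H1. lra.
  - replace z with (f s v) by lra. rewrite gf by auto.
    apply Rle_lt_trans with r; [|unfold r; lra].
    apply Rabs_le. unfold r in *. lra.
Qed.

Lemma inverse_family_derive_t t x : J t ->
  is_derive (fun s => g s x) t (- dt f t (g t x) / dx f t (g t x)).
Proof.
  intros Ht. apply (implicit_derivative f (fun s => g s x)); auto.
  - apply (js_differentiable J); auto.
  - apply continuity_pt_filterlim. intros e He.
    destruct (inverse_family_continuity t x Ht (mkposreal e He)) as [d Hd].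
    exists d. split; [apply cond_pos|]. intros s [_ Hs].
    apply Hd; [exact Hs|]. rewrite Rminus_diag, Rabs_R0. apply cond_pos.
  - apply (filter_imp J); [|exact (HJ t Ht)]. intros s Hs. rewrite !fg; auto.
Qed.

(** With time frozen, the space variable takes the role of the parameter: g_t solves f_t(y) - s = 0,
    whose partial in the parameter s is -1. *)
Lemma inverse_family_derive_x t x : J t ->
  is_derive (fun y => g t y) x (1 / dx f t (g t x)).
Proof.
  intros Ht. replace 1 with (- -1) by ring.
  assert (HT : open all_times) by apply open_true.
  assert (Hjs : jointly_smooth all_times (fun s y => f t y + -1 * s)).
  { apply js_plus; auto.
    - apply js_of_smooth; auto. apply (js_slice_smooth J); auto.
    - apply js_mult; auto; [apply js_const | apply js_fst]; auto. }
  apply (implicit_derivative (fun s y => f t y + -1 * s)); auto.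
  - assert (D := js_differentiable all_times HT _ x (g t x) Hjs I).
    replace (dt _ x (g t x)) with (-1) in D.
    + replace (dx (fun s y => f t y + -1 * s) x (g t x)) with (dx f t (g t x)) in D;
        [exact D|].
      symmetry. apply is_derive_unique. auto_derive.
      * eexists. apply (js_derivatives J f Hf); auto.
      * unfold dx. ring.
    + symmetry. apply is_derive_unique. auto_derive; auto. ring.
  - apply continuity_pt_filterlim. intros e He.
    destruct (inverse_family_continuity t x Ht (mkposreal e He)) as [d Hd].
    exists d. split; [apply cond_pos|]. intros s [_ Hs].
    apply Hd; [|exact Hs]. rewrite Rminus_diag, Rabs_R0. apply cond_pos.
  - apply filter_forall. intros s. rewrite !fg; auto. ring.
Qed.

(** Bootstrap: the partials of [g] are rational expressions in derivatives of [f] evaluated along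
    [g], so order [n] for [g] yields order [n + 1]. *)
Lemma js_inverse_family : jointly_smooth J g.
Proof.
  apply js_Ck. intros n. induction n as [|n IH].
  - intros t x Ht. split; [|exact I]. apply inverse_family_continuity; auto.
  - assert (Hi : Ck J n (fun t x => / dx f t (g t x))).
    { apply Ck_inv; auto. apply Ck_comp; auto. apply js_dx; auto. }
    apply (Ck_S J n g (fun t x => (-1) * dt f t (g t x) * / dx f t (g t x))
                      (fun t x => 1 * / dx f t (g t x))); auto.
    + intros t x Ht. replace (-1 * dt f t (g t x)) with (- dt f t (g t x)) by ring.
      apply inverse_family_derive_t; auto.
    + intros t x Ht. apply inverse_family_derive_x; auto.
    + apply Ck_mult; auto. apply Ck_mult; auto using Ck_const.
      apply Ck_comp; auto. apply js_dt; auto.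
    + apply Ck_mult; auto using Ck_const.
Qed.

End InverseFamily.

(** * Functions on the circle, the L2 metric and the Gelfand-Fuchs cocycle *)

Lemma open_all_times : open all_times.
Proof. exact open_true. Qed.

Lemma smooth_js f : smooth f <-> jointly_smooth all_times (fun _ x => f x).
Proof.
  split; intros Hf.
  - apply js_of_smooth; auto using open_all_times.
  - exact (js_slice_smooth all_times _ 0 Hf I).
Qed.

Lemma smooth_is_derive f x : smooth f -> is_derive f x (Derive f x).
Proof. intros Hf. apply Derive_correct. exact (Hf 1%nat x). Qed.

Lemma smooth_continuous f x : smooth f -> continuous f x.
Proof. intros Hf. apply (ex_derive_continuous f). exact (Hf 1%nat x). Qed.

Lemma smooth_const c : smooth (fun _ => c).
Proof. apply smooth_js, js_const, open_all_times. Qed.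

Lemma smooth_plus f g : smooth f -> smooth g -> smooth (fun x => f x + g x).
Proof. rewrite !smooth_js. apply js_plus, open_all_times. Qed.

Lemma smooth_mult f g : smooth f -> smooth g -> smooth (fun x => f x * g x).
Proof. rewrite !smooth_js. apply js_mult, open_all_times. Qed.

Lemma smooth_div f g : (forall x, g x <> 0) ->
  smooth f -> smooth g -> smooth (fun x => f x / g x).
Proof.
  intros Hg. rewrite !smooth_js. apply js_div; auto using open_all_times.
Qed.

Lemma smooth_comp f g : smooth f -> smooth g -> smooth (fun x => f (g x)).
Proof.
  rewrite !smooth_js. intros Hf Hg.
  exact (js_comp all_times open_all_times _ _ Hf Hg).
Qed.

Lemma smooth_Derive f : smooth f -> smooth (Derive f).
Proof. rewrite !smooth_js. apply js_dx. Qed.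

Lemma Derive_shift f a x : Derive (fun y => f (y + a)) x = Derive f (x + a).
Proof.
  exact (Derive_n_comp_trans f 1 x a).
Qed.

Lemma periodic_Derive f : periodic f -> periodic (Derive f).
Proof.
  intros Hf x. rewrite <- Derive_shift. apply Derive_ext. exact Hf.
Qed.

Lemma periodic_IZR f d x : periodic f -> f (x + IZR d) = f x.
Proof.
  intros Hf.
  assert (HN : forall n y, f (y + INR n) = f y).
  { intros n. induction n as [|n IH]; intros y.
    - simpl. f_equal. ring.
    - rewrite S_INR, <- Rplus_assoc, Hf. apply IH. }
  destruct (Z_le_gt_dec 0 d) as [Hd|Hd].
  - rewrite <- (Z2Nat.id d), <- INR_IZR_INZ by lia. apply HN.
  - rewrite <- (HN (Z.to_nat (- d)) (x + IZR d)), INR_IZR_INZ, Z2Nat.id by lia.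
    rewrite opp_IZR. f_equal. ring.
Qed.

Notation scf := smooth_circle_function.

Lemma scf_const c : scf (fun _ => c).
Proof. split; [apply smooth_const|intros x; reflexivity]. Qed.

Lemma scf_plus u v : scf u -> scf v -> scf (fun x => u x + v x).
Proof.
  intros [Su Pu] [Sv Pv]. split; [apply smooth_plus; auto|].
  intros x. rewrite Pu, Pv. reflexivity.
Qed.

Lemma scf_mult u v : scf u -> scf v -> scf (fun x => u x * v x).
Proof.
  intros [Su Pu] [Sv Pv]. split; [apply smooth_mult; auto|].
  intros x. rewrite Pu, Pv. reflexivity.
Qed.

Lemma scf_minus u v : scf u -> scf v -> scf (fun x => u x - v x).
Proof.
  intros Hu Hv. replace (fun x => u x - v x) with (fun x => u x + (-1) * v x)
    by (extensionality x; ring).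
  apply scf_plus; auto. apply scf_mult; auto using scf_const.
Qed.

Lemma scf_Derive u : scf u -> scf (Derive u).
Proof. intros [Su Pu]. split; auto using smooth_Derive, periodic_Derive. Qed.

Lemma scf_Derive_n u n : scf u -> scf (Derive_n u n).
Proof. intros Hu. induction n as [|n IH]; [auto | apply scf_Derive, IH]. Qed.

Lemma scf_comp u f : scf u -> smooth_circle_map f -> scf (fun x => u (f x)).
Proof.
  intros [Su Pu] [Sf [d Hd]]. split; [apply smooth_comp; auto|].
  intros x. rewrite Hd. apply periodic_IZR, Pu.
Qed.

Lemma scf_pull u (phi : DiffS1) : scf u -> scf (fun x => u (phi x)).
Proof. intros Hu. apply scf_comp; auto. apply lift_smooth. Qed.

Lemma scf_push u (phi : DiffS1) : scf u -> scf (fun x => u (lift_inv phi x)).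
Proof. intros Hu. apply scf_comp; auto. apply lift_inv_smooth. Qed.

(** The inverse is smooth too, so by the chain rule the two derivatives multiply to 1. *)
Lemma lift_immersion (phi : DiffS1) x : Derive phi x <> 0.
Proof.
  intros H0.
  assert (D : is_derive (fun y => lift_inv phi (phi y)) x
                (Derive phi x * Derive (lift_inv phi) (phi x))).
  { apply (is_derive_comp (lift_inv phi) phi).
    - apply smooth_is_derive, lift_inv_smooth.
    - apply smooth_is_derive, lift_smooth. }
  assert (D1 : is_derive (fun y => lift_inv phi (phi y)) x 1).
  { apply (is_derive_ext (fun y => y)).
    - intros y. symmetry. apply liftK.
    - apply is_derive_var. }
  apply is_derive_unique in D, D1. rewrite D1, H0 in D. lra.
Qed.

(** The degree enters only as an additive constant, which differentiation removes. *)
Lemma scf_Derive_lift (phi : DiffS1) : scf (Derive phi).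
Proof.
  destruct (lift_smooth phi) as [S [d Hd]]. split; [apply smooth_Derive, S|].
  intros x. rewrite <- Derive_shift.
  rewrite (Derive_ext _ (fun y => phi y + IZR d)); auto.
  rewrite Derive_plus, Derive_const; [ring|exact (S 1%nat x)|].
  apply ex_derive_const.
Qed.

Lemma scf_div u v : (forall x, v x <> 0) -> scf u -> scf v ->
  scf (fun x => u x / v x).
Proof.
  intros Hv [Su Pu] [Sv Pv]. split; [apply smooth_div; auto|].
  intros x. rewrite Pu, Pv. reflexivity.
Qed.

(** * Integration over the circle *)

Lemma RInt_Derive_scf u : scf u -> RInt (Derive u) 0 1 = 0 :> R.
Proof.
  intros [Su Pu]. rewrite RInt_Derive.
  - rewrite <- (Pu 0), Rplus_0_l. apply Rminus_diag.
  - intros x _. exact (Su 1%nat x).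
  - intros x _. apply smooth_continuous, smooth_Derive, Su.
Qed.

Lemma ex_RInt_scf u a b : scf u -> ex_RInt u a b.
Proof.
  intros [Su _]. apply (ex_RInt_continuous (V := R_CompleteNormedModule)).
  intros x _. apply smooth_continuous, Su.
Qed.

Lemma RInt_plus_scf u v : scf u -> scf v ->
  RInt (fun x => u x + v x) 0 1 = RInt u 0 1 + RInt v 0 1 :> R.
Proof.
  intros Hu Hv. apply (RInt_plus (V := R_CompleteNormedModule));
    apply ex_RInt_scf; auto.
Qed.

Lemma RInt_scal_scf k u : scf u ->
  RInt (fun x => k * u x) 0 1 = k * RInt u 0 1 :> R.
Proof.
  intros Hu. apply (RInt_scal (V := R_CompleteNormedModule)).
  apply ex_RInt_scf; auto.
Qed.

Lemma RInt_lin_scf a b u v : scf u -> scf v ->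
  RInt (fun x => a * u x + b * v x) 0 1 = a * RInt u 0 1 + b * RInt v 0 1 :> R.
Proof.
  intros Hu Hv.
  rewrite RInt_plus_scf, !RInt_scal_scf; auto;
    apply scf_mult; auto using scf_const.
Qed.

(** The form in which integration by parts is used: adding an exact derivative leaves the integral
    over the circle unchanged. *)
Lemma RInt_eq_of_Derive u v w : scf u -> scf v -> scf w ->
  (forall x, u x = v x + Derive w x) -> RInt u 0 1 = RInt v 0 1 :> R.
Proof.
  intros Hu Hv Hw E. rewrite (functional_extensionality _ _ E).
  rewrite RInt_plus_scf, RInt_Derive_scf; auto using scf_Derive. ring.
Qed.

(** * The L2 inner product *)

Lemma L2_lin_l a b u v w : scf u -> scf v -> scf w ->
  L2 (fun x => a * u x + b * v x) w = a * L2 u w + b * L2 v w.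
Proof.
  intros Hu Hv Hw. unfold L2. rewrite <- RInt_lin_scf by (apply scf_mult; auto).
  f_equal. extensionality x. ring.
Qed.

Lemma L2_sym u v : L2 u v = L2 v u.
Proof. unfold L2. f_equal. extensionality x. ring. Qed.

Lemma L2_pos u : scf u -> (exists x, u x <> 0) -> 0 < L2 u u.
Proof.
  intros Hu [x0 Hx0].
  assert (Hs : scf (fun x => u x * u x)) by (apply scf_mult; auto).
  destruct (Rle_lt_dec (L2 u u) 0) as [Hle|]; [exfalso|assumption].
  set (F := fun y => RInt (fun x => u x * u x) 0 y).
  assert (DF : forall y, is_derive F y (u y * u y)).
  { intros y. apply (is_derive_RInt (fun x => u x * u x) F 0 y).
    - apply filter_forall. intros z.
      apply (RInt_correct (V := R_CompleteNormedModule)), ex_RInt_scf, Hs.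
    - apply smooth_continuous, Hs. }
  (* A nonnegative integrand with zero integral has a constant primitive. *)
  assert (Mono : forall y z, y <= z -> F y <= F z).
  { intros y z Hyz. destruct (MVT_gen F y z (fun x => u x * u x)) as (c & _ & E).
    - auto.
    - intros x _. apply continuity_pt_filterlim.
      apply (ex_derive_continuous F). eexists; apply DF.
    - assert (0 <= u c * u c) by apply Rle_0_sqr. nra. }
  assert (F0 : F 0 = 0) by apply (RInt_point (V := R_CompleteNormedModule)).
  assert (Z : forall y, 0 < y < 1 -> u y = 0).
  { intros y Hy. assert (D0 : is_derive F y 0).
    - apply (is_derive_ext_loc (fun _ => 0)); [|apply is_derive_cst].
      apply (filter_imp (fun z => 0 < z /\ z < 1)).
      + intros z Hz. assert (H1 := Mono 0 z). assert (H2 := Mono z 1).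
        unfold L2 in Hle. fold (F 1) in Hle. lra.
      + apply (open_and _ _ (open_gt 0) (open_lt 1)); auto.
    - assert (D1 := DF y). apply is_derive_unique in D0, D1.
      rewrite D0 in D1. apply Rsqr_0_uniq. symmetry. exact D1. }
  (* Continuity adds the endpoint 0: [z] lies in the open interval, yet so close to [y] that u(z)
     could not vanish if u(y) did not. *)
  assert (Z2 : forall y, 0 <= y < 1 -> u y = 0).
  { intros y Hy. destruct (Req_dec (u y) 0) as [|Hn]; auto. exfalso.
    destruct (proj1 (filterlim_locally u (u y))
       (smooth_continuous u y (proj1 Hu)) (mkposreal _ (Rabs_pos_lt _ Hn)))
      as [d Hd].
    set (z := y + Rmin (d / 2) ((1 - y) / 2)).
    assert (Hm : 0 < Rmin (d / 2) ((1 - y) / 2))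
      by (apply Rmin_glb_lt; [apply is_pos_div_2|lra]).
    assert (Hm1 : Rmin (d / 2) ((1 - y) / 2) <= d / 2) by apply Rmin_l.
    assert (Hm2 : Rmin (d / 2) ((1 - y) / 2) <= (1 - y) / 2) by apply Rmin_r.
    assert (Hb : ball y d z).
    { change (Rabs (z - y) < d). unfold z.
      rewrite Rabs_pos_eq; [|lra]. destruct d as [d Hdp]; simpl in *; lra. }
    specialize (Hd z Hb). change (Rabs (u z - u y) < Rabs (u y)) in Hd.
    rewrite (Z z) in Hd by (unfold z; lra).
    rewrite Rminus_0_l, Rabs_Ropp in Hd. lra. }
  (* Periodicity reduces an arbitrary point to its fractional part, which lies in [0, 1). *)
  apply Hx0. rewrite <- (Z2 (frac_part x0)).
  - rewrite <- (periodic_IZR u (Int_part x0) (frac_part x0)) by apply Hu.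
    f_equal. unfold frac_part. ring.
  - destruct (base_fp x0). lra.
Qed.

Lemma L2_inner_product : inner_product L2.
Proof.
  split; [split|split].
  - intros a b u v w Hu Hv Hw. apply L2_lin_l; auto.
  - intros a b u v w Hu Hv Hw. rewrite !(L2_sym w). apply L2_lin_l; auto.
  - intros u v _ _. apply L2_sym.
  - intros u Hu Hx. apply L2_pos; auto.
Qed.

(** * Integration by parts and the Gelfand-Fuchs cocycle *)

Lemma Derive_mult_scf u v x : scf u -> scf v ->
  Derive (fun y => u y * v y) x = Derive u x * v x + u x * Derive v x.
Proof.
  intros Hu Hv. apply Derive_mult; [apply (proj1 Hu 1%nat)|apply (proj1 Hv 1%nat)].
Qed.

Lemma L2_by_parts u v : scf u -> scf v -> L2 u (Derive v) = - L2 (Derive u) v.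
Proof.
  intros Hu Hv. unfold L2.
  rewrite (RInt_eq_of_Derive (fun x => u x * Derive v x)
     (fun x => (-1) * (Derive u x * v x)) (fun x => u x * v x));
    auto using scf_mult, scf_const, scf_Derive.
  - rewrite RInt_scal_scf; [ring|]. apply scf_mult; auto using scf_Derive.
  - intros x. rewrite Derive_mult_scf; auto. ring.
Qed.

(** Three integrations by parts; their odd number produces the sign, and with it both the
    antisymmetry of the cocycle and the sign of the Lorentz force. *)
Lemma gelfand_fuchs_L2 u v : scf u -> scf v ->
  gelfand_fuchs u v = - L2 (Derive_n u 3) v.
Proof.
  intros Hu Hv. change (gelfand_fuchs u v) with (L2 u (Derive (Derive (Derive v)))).
  change (Derive_n u 3) with (Derive (Derive (Derive u))).
  rewrite !L2_by_parts by auto using scf_Derive. ring.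
Qed.

Lemma gelfand_fuchs_antisym u v : scf u -> scf v ->
  gelfand_fuchs u v = - gelfand_fuchs v u.
Proof.
  intros Hu Hv. rewrite gelfand_fuchs_L2, L2_sym; auto.
Qed.

Lemma gelfand_fuchs_lin_l a b u v w : scf u -> scf v -> scf w ->
  gelfand_fuchs (fun x => a * u x + b * v x) w =
  a * gelfand_fuchs u w + b * gelfand_fuchs v w.
Proof.
  intros Hu Hv Hw. apply (L2_lin_l a b u v (Derive_n w 3)); auto.
  apply scf_Derive_n; auto.
Qed.

Lemma scf_bracket u v : scf u -> scf v -> scf (bracket u v).
Proof.
  intros Hu Hv. apply scf_minus; apply scf_mult; auto using scf_Derive.
Qed.

Lemma Derive_plus_scf u v x : scf u -> scf v ->
  Derive (fun y => u y + v y) x = Derive u x + Derive v x.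
Proof.
  intros Hu Hv. apply Derive_plus; [apply (proj1 Hu 1%nat)|apply (proj1 Hv 1%nat)].
Qed.

Lemma Derive_bracket u v x : scf u -> scf v ->
  Derive (bracket u v) x = u x * Derive (Derive v) x - Derive (Derive u) x * v x.
Proof.
  intros Hu Hv. assert (Su := scf_Derive u Hu). assert (Sv := scf_Derive v Hv).
  unfold bracket. rewrite Derive_minus.
  - rewrite !Derive_mult_scf by auto. ring.
  - apply (scf_mult u (Derive v) Hu Sv) with (n := 1%nat).
  - apply (scf_mult (Derive u) v Su Hv) with (n := 1%nat).
Qed.

(* The cyclic sum is the integral of the derivative of the Wronskian
   determinant of u, v and w. *)
Lemma gelfand_fuchs_cocycle u v w : scf u -> scf v -> scf w ->
  gelfand_fuchs (bracket u v) w + gelfand_fuchs (bracket v w) u +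
  gelfand_fuchs (bracket w u) v = 0.
Proof.
  intros Hu Hv Hw.
  assert (HB : forall f g h, scf f -> scf g -> scf h ->
    scf (fun x => bracket f g x * Derive (Derive h) x))
    by (intros; apply scf_mult; auto using scf_bracket, scf_Derive).
  set (W := fun x =>
    bracket u v x * Derive (Derive w) x + bracket v w x * Derive (Derive u) x +
    bracket w u x * Derive (Derive v) x).
  assert (HW : scf W)
    by (apply scf_plus; [apply (scf_plus _ _ (HB u v w Hu Hv Hw))|]; auto).
  rewrite <- (RInt_Derive_scf W HW). unfold gelfand_fuchs.
  assert (HI : forall f g h, scf f -> scf g -> scf h ->
    scf (fun x => bracket f g x * Derive_n h 3 x))
    by (intros; apply scf_mult; auto using scf_bracket, scf_Derive_n).
  rewrite <- RInt_plus_scf, <- RInt_plus_scf by auto using scf_plus.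
  f_equal. extensionality x. unfold W.
  rewrite Derive_plus_scf, Derive_plus_scf by auto using scf_plus.
  rewrite !Derive_mult_scf by auto using scf_bracket, scf_Derive.
  rewrite !Derive_bracket by auto.
  change (Derive_n ?f 3 x) with (Derive (Derive (Derive f)) x).
  match goal with |- ?l = ?r => change (l = r :> R) end. ring.
Qed.

Lemma gelfand_fuchs_two_cocycle k : two_cocycle (fun u v => k * gelfand_fuchs u v).
Proof.
  split; [split|split].
  - intros a b u v w Hu Hv Hw. rewrite gelfand_fuchs_lin_l; auto. ring.
  - intros a b u v w Hu Hv Hw.
    assert (Hs : scf (fun x => a * u x + b * v x))
      by (apply scf_plus; apply scf_mult; auto using scf_const).
    rewrite (gelfand_fuchs_antisym w _), gelfand_fuchs_lin_l by auto.
    rewrite (gelfand_fuchs_antisym w u), (gelfand_fuchs_antisym w v) by auto. ring.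
  - intros u v Hu Hv. rewrite gelfand_fuchs_antisym by auto. ring.
  - intros u v w Hu Hv Hw. rewrite <- !Rmult_plus_distr_l.
    rewrite gelfand_fuchs_cocycle; auto. ring.
Qed.

(** * The Levi-Civita connection *)

Section SmoothFields.

Variable J : R -> Prop.
Hypothesis HJ : open J.

Lemma scf_field X t : smooth_field J X -> J t -> scf (X t).
Proof.
  intros [SX PX] Ht. split; auto. apply (js_slice_smooth J); auto.
Qed.

Lemma field_plus X Z : smooth_field J X -> smooth_field J Z ->
  smooth_field J (fun t x => X t x + Z t x).
Proof.
  intros [SX PX] [SZ PZ]. split; [apply js_plus; auto|].
  intros t Ht x. rewrite PX, PZ; auto.
Qed.

Lemma field_mult X Z : smooth_field J X -> smooth_field J Z ->
  smooth_field J (fun t x => X t x * Z t x).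
Proof.
  intros [SX PX] [SZ PZ]. split; [apply js_mult; auto|].
  intros t Ht x. rewrite PX, PZ; auto.
Qed.

Lemma field_div X Z : (forall t x, J t -> Z t x <> 0) ->
  smooth_field J X -> smooth_field J Z ->
  smooth_field J (fun t x => X t x / Z t x).
Proof.
  intros Hnz [SX PX] [SZ PZ]. split; [apply js_div; auto|].
  intros t Ht x. rewrite PX, PZ; auto.
Qed.

Lemma field_dt X : smooth_field J X -> smooth_field J (dt X).
Proof.
  intros [SX PX]. split; [apply js_dt; auto|].
  intros t Ht x. apply Derive_ext_loc.
  apply (filter_imp J); [|exact (HJ t Ht)]. intros s Hs. apply PX; auto.
Qed.

Lemma field_dx X : smooth_field J X -> smooth_field J (dx X).
Proof.
  intros [SX PX]. split; [apply js_dx; auto|].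
  intros t Ht. apply (periodic_Derive (X t)); auto.
Qed.

Variable c : R -> DiffS1.
Hypothesis Hc : smooth_curve J c.

(** A smooth curve is one whose lifts are jointly smooth; for the inverses this has to be
    derived. *)
Lemma js_lift_inv : jointly_smooth J (fun t x => lift_inv (c t) x).
Proof.
  apply (js_inverse_family J (fun t x => c t x)); auto.
  - intros t x _. apply lift_invK.
  - intros t x _. apply liftK.
  - intros t x _. apply (lift_immersion (c t)).
Qed.

Lemma field_push X : smooth_field J X ->
  smooth_field J (fun t x => X t (lift_inv (c t) x)).
Proof.
  intros [SX PX]. split.
  - apply (js_comp J HJ X (fun t x => lift_inv (c t) x)); auto using js_lift_inv.
  - intros t Ht x. destruct (lift_inv_smooth (c t)) as [_ [d Hd]].
    rewrite Hd. apply periodic_IZR; auto.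
Qed.

Lemma field_Derive_lift : smooth_field J (fun t => Derive (c t)).
Proof.
  split.
  - apply (js_dx J (fun t x => c t x)); auto.
  - intros t _. apply scf_Derive_lift.
Qed.

(* The degree is an integer depending continuously on time, hence locally
   constant. *)
Lemma velocity_periodic t : J t -> periodic (velocity c t).
Proof.
  intros Ht x. unfold velocity.
  destruct (js_derivatives J _ Hc) as [Dt _].
  assert (Cy : forall y, continuous (fun r => c r y) t).
  { intros y. apply (ex_derive_continuous (fun r => c r y)). eexists. apply Dt; auto. }
  destruct (lift_smooth (c t)) as [_ [d Hd]].
  assert (C : continuous (fun r => minus (c r (x + 1)) (c r x)) t)
    by (apply (continuous_minus (fun r => c r (x + 1))); apply Cy).
  assert (L := proj1 (filterlim_locally _ _) C (mkposreal 1 Rlt_0_1)).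
  rewrite (Derive_ext_loc _ (fun r => c r x + IZR d)).
  - rewrite Derive_plus, Derive_const; [ring| |apply ex_derive_const].
    eexists. apply Dt; auto.
  - apply (filter_imp (fun r =>
      ball (minus (c t (x + 1)) (c t x)) (mkposreal 1 Rlt_0_1)
        (minus (c r (x + 1)) (c r x)))); [|exact L].
    intros r Hr. destruct (lift_smooth (c r)) as [_ [e He]].
    change (Rabs ((c r (x + 1) - c r x) - (c t (x + 1) - c t x)) < 1) in Hr.
    rewrite Hd, He in Hr.
    replace (c r x + IZR e - c r x - (c t x + IZR d - c t x)) with (IZR (e - d)) in Hr
      by (rewrite minus_IZR; ring).
    apply Rabs_def2 in Hr.
    assert (e - d = 0)%Z by (apply one_IZR_lt1; lra).
    rewrite He. do 2 f_equal. lia.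
Qed.

Lemma field_velocity : smooth_field J (velocity c).
Proof.
  split; [|exact velocity_periodic].
  apply (js_dt J (fun t x => c t x)); auto.
Qed.

End SmoothFields.

(** In Eulerian terms, with X = u o phi and Z = v o phi, this is (u v)_x o phi. *)
Definition Gamma_L2 : christoffel := fun phi X Z x =>
  (Derive X x * Z x + X x * Derive Z x) / Derive phi x.

Lemma Gamma_L2_scf phi X Z : scf X -> scf Z -> scf (Gamma_L2 phi X Z).
Proof.
  intros HX HZ. apply scf_div.
  - intros x. apply lift_immersion.
  - apply scf_plus; apply scf_mult; auto using scf_Derive.
  - apply scf_Derive_lift.
Qed.

Lemma Derive_lin a b u v x : scf u -> scf v ->
  Derive (fun y => a * u y + b * v y) x = a * Derive u x + b * Derive v x.
Proof.
  intros Hu Hv. apply is_derive_unique.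
  auto_derive; [|unfold Derive; ring].
  split; [apply (proj1 Hu 1%nat)|split; [apply (proj1 Hv 1%nat)|exact I]].
Qed.

Lemma Gamma_L2_connection : connection Gamma_L2.
Proof.
  split; [exact Gamma_L2_scf|split].
  - intros phi x. split; intros a b u v w Hu Hv Hw; unfold Gamma_L2;
      rewrite Derive_lin by auto; field; apply lift_immersion.
  - intros c X Z Hc HX HZ. apply field_div; auto using open_all_times.
    + intros t x _. apply lift_immersion.
    + apply field_plus; auto using open_all_times;
        apply field_mult; auto using open_all_times;
        apply field_dx; auto.
    + apply field_Derive_lift; auto.
Qed.

Lemma Gamma_L2_metric_compatible :
  metric_compatible (right_invariant L2) Gamma_L2.
Proof.
  intros c X Z Hc HX HZ t.
  assert (HO := open_all_times).
  set (g := fun r x => lift_inv (c r) x).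
  set (V := velocity c).
  assert (HV : smooth_field all_times V) by (apply field_velocity; auto).
  (* The integrand of the metric on the fixed domain [0, 1], to be differentiated under the integral
     sign. *)
  set (q := fun r x => X r (g r x) * Z r (g r x)).
  assert (Hq : smooth_field all_times q)
    by (apply field_mult; auto; apply field_push; auto).
  (* The factor 2: the Christoffel terms give (2 V' X Z + V (X Z)') / phi', and the motion of the
     inverse accounts for another V (X Z)' / phi'. *)
  set (p := fun r x => 2 * (V r x * (X r x * Z r x))).
  assert (Hp : smooth_field all_times p).
  { apply (field_mult _ HO (fun _ _ => 2)).
    - split; [apply js_const; auto|intros ? ? ?; reflexivity].
    - apply field_mult; auto. apply field_mult; auto. }
  assert (Hcov : forall Y, smooth_field all_times Y ->
    scf (cov_deriv Gamma_L2 c Y t)).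
  { intros Y HY. apply scf_plus.
    - apply (scf_field all_times (dt Y)); [apply field_dt|exact I]; auto.
    - apply Gamma_L2_scf; apply (scf_field all_times); auto; exact I. }
  assert (HXt := scf_field all_times X t HX I).
  assert (HZt := scf_field all_times Z t HZ I).
  assert (HVt := scf_field all_times V t HV I).
  unfold right_invariant.
  replace (_ + _) with (RInt (fun x => dt q t x) 0 1).
  - apply (is_derive_RInt_param q 0 1 t).
    + apply filter_forall. intros r y _. exists (dt q r y).
      exact (proj1 (js_derivatives all_times q (proj1 Hq)) r y I).
    + intros y _. apply (Ck_continuity all_times 0 (dt q)); [|exact I].
      apply js_Ck, js_dt, Hq.
    + apply filter_forall. intros r. apply ex_RInt_scf.
      apply (scf_field all_times q); auto. exact I.
  - symmetry. unfold L2.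
    rewrite <- RInt_plus_scf by
      (apply scf_mult; apply (scf_push (fun y => _ y)); auto).
    (* Moving the time derivative through the inverse costs the divergence of
       the Eulerian field 2 V X Z, whose integral vanishes. *)
    apply (RInt_eq_of_Derive _ _ (fun x => p t (g t x))).
    + apply scf_plus; apply scf_mult; apply (scf_push (fun y => _ y)); auto.
    + apply (scf_field all_times (dt q)); [apply field_dt|exact I]; auto.
    + apply (scf_push (p t)). apply (scf_field all_times); auto. exact I.
    + intros x. set (y := g t x).
      assert (Hn : Derive (c t) y <> 0) by apply lift_immersion.
      assert (Dg : is_derive (fun r => g r x) t (- V t y / Derive (c t) y)).
      { apply (inverse_family_derive_t all_times (fun r z => c r z) g); auto.
        - intros r z _. apply lift_invK.
        - intros r z _. apply liftK.
        - intros r z _. apply (lift_immersion (c r)).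
        - exact I. }
      assert (Dgx : is_derive (g t) x (1 / Derive (c t) y)).
      { apply (inverse_family_derive_x all_times (fun r z => c r z) g); auto.
        - intros r z _. apply lift_invK.
        - intros r z _. apply liftK.
        - intros r z _. apply (lift_immersion (c r)).
        - exact I. }
      assert (Ep : Derive (fun z => p t (g t z)) x =
        2 * (Derive (V t) y * (X t y * Z t y) +
             V t y * (Derive (X t) y * Z t y + X t y * Derive (Z t) y))
          * (1 / Derive (c t) y)).
      { apply is_derive_unique.
        rewrite Rmult_comm. apply (is_derive_comp (p t) (g t)); auto.
        unfold p. auto_derive.
        - repeat split; [apply (proj1 HVt 1%nat)|apply (proj1 HXt 1%nat)|
                         apply (proj1 HZt 1%nat)].
        - unfold y.
          change (Derive (fun x0 => V t x0)) with (Derive (V t)).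
          change (Derive (fun x0 => X t x0)) with (Derive (X t)).
          change (Derive (fun x0 => Z t x0)) with (Derive (Z t)). ring. }
      assert (Eq : dt q t x =
        (dt X t y + Derive (X t) y * (- V t y / Derive (c t) y)) * Z t y +
        X t y * (dt Z t y + Derive (Z t) y * (- V t y / Derive (c t) y))).
      { apply is_derive_unique.
        apply (is_derive_mult (fun r => X r (g r x)) (fun r => Z r (g r x)) t
          (dt X t y + Derive (X t) y * (- V t y / Derive (c t) y))
          (dt Z t y + Derive (Z t) y * (- V t y / Derive (c t) y)));
          [| |exact Rmult_comm].
        - apply (chain_t all_times HO X g); [apply HX|exact I|exact Dg].
        - apply (chain_t all_times HO Z g); [apply HZ|exact I|exact Dg]. }
      rewrite Ep, Eq. unfold cov_deriv, Gamma_L2.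
      change (velocity c t) with (V t). change (lift_inv (c t) x) with y.
      change (Derive (fun r => X r y) t) with (dt X t y).
      change (Derive (fun r => Z r y) t) with (dt Z t y).
      field. exact Hn.
Qed.

Lemma Gamma_L2_levi_civita : levi_civita (right_invariant L2) Gamma_L2.
Proof.
  split; [exact Gamma_L2_connection|split; [|exact Gamma_L2_metric_compatible]].
  intros phi X Z x _ _. unfold Gamma_L2. f_equal. ring.
Qed.

Lemma scf_bounded u : scf u -> exists M, forall x, Rabs (u x) <= M.
Proof.
  intros [Su Pu].
  destruct (bounded_continuity (K := R_AbsRing) (V := R_NormedModule) u 0 1)
    as [M HM].
  - intros x _. apply (smooth_continuous u x Su).
  - exists M. intros x.
    replace (u x) with (u (frac_part x)).
    + apply Rlt_le, (HM (frac_part x)). destruct (base_fp x). lra.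
    + rewrite <- (periodic_IZR u (Int_part x) (frac_part x) Pu).
      f_equal. unfold frac_part. ring.
Qed.

(** * Diffeomorphisms near the identity and curves through a given diffeomorphism *)

Section NearIdentity.

Variable w : R -> R.
Hypothesis Hw : scf w.
Hypothesis Hsmall : forall x, Rabs (Derive w x) <= 1 / 2.

Lemma near_identity_lipschitz x y : Rabs (w y - w x) <= 1 / 2 * Rabs (y - x).
Proof.
  destruct (MVT_gen w x y (Derive w)) as (z & _ & E).
  - intros z _. apply smooth_is_derive, Hw.
  - intros z _. apply continuity_pt_filterlim, (smooth_continuous w z), Hw.
  - rewrite E, Rabs_mult. apply Rmult_le_compat_r; [apply Rabs_pos|auto].
Qed.

Lemma near_identity_injective x y : x + w x = y + w y -> x = y.
Proof.
  intros E. assert (L := near_identity_lipschitz x y).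
  replace (w y - w x) with (- (y - x)) in L by lra.
  rewrite Rabs_Ropp in L. apply Rminus_diag_uniq_sym.
  destruct (Req_dec (y - x) 0) as [|Hn]; auto.
  apply Rabs_pos_lt in Hn. lra.
Qed.

(** The preimage is given as a [sig] so that it can be projected to define the inverse map. *)
Lemma near_identity_surjective y : {x | x + w x = y}.
Proof.
  (* As |w(N)| and |w(-N)| are at most |w(0)| + N / 2, this [N] forces a sign change of x + w(x) - y
     between -N and N. *)
  set (N := 2 * (Rabs y + Rabs (w 0)) + 1).
  assert (A1 := Rle_abs y). assert (A2 := Rle_abs (w 0)).
  assert (A3 := Rabs_maj2 y). assert (A4 := Rabs_maj2 (w 0)).
  assert (HN : 0 < N) by (unfold N; lra).
  destruct (IVT_cor (fun x => x + w x - y) (- N) N) as (x & _ & E).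
  - intros x. apply continuity_pt_filterlim.
    apply (ex_derive_continuous (fun x => x + w x - y)).
    auto_derive. apply (proj1 Hw 1%nat).
  - lra.
  - assert (H1 := near_identity_lipschitz 0 N).
    assert (H2 := near_identity_lipschitz 0 (- N)).
    rewrite Rminus_0_r in H1, H2. rewrite Rabs_Ropp in H2.
    rewrite (Rabs_pos_eq N) in H1, H2 by lra.
    apply Rabs_le_between in H1, H2.
    assert (- N + w (- N) - y <= 0) by (unfold N in *; lra).
    assert (0 <= N + w N - y) by (unfold N in *; lra). nra.
  - exists x. lra.
Qed.

Lemma near_identity_diffeo : {psi : DiffS1 | forall x, psi x = x + w x}.
Proof.
  set (f := fun x => x + w x).
  set (g := fun y => proj1_sig (near_identity_surjective y)).
  assert (fg : forall y, f (g y) = y)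
    by (intros y; exact (proj2_sig (near_identity_surjective y))).
  assert (gf : forall x, g (f x) = x)
    by (intros x; apply near_identity_injective, fg).
  assert (Sf : smooth f).
  { apply smooth_plus; [|apply Hw]. apply smooth_js, js_snd, open_all_times. }
  assert (Hf1 : forall x, f (x + 1) = f x + IZR 1).
  { intros x. unfold f. rewrite (proj2 Hw x). simpl. ring. }
  assert (Sg : smooth g).
  { apply smooth_js.
    (* A single map is treated as a family constant in time. *)
    apply (js_inverse_family all_times (fun _ x => f x) (fun _ y => g y));
      auto using open_all_times.
    - apply smooth_js, Sf.
    - intros s x _. unfold dx, f. intros H0.
      rewrite Derive_plus, Derive_id in H0; [|apply ex_derive_id|apply (proj1 Hw 1%nat)].
      assert (B := Hsmall x). apply Rabs_le_between in B.
      change (Derive (fun x0 => w x0) x) with (Derive w x) in H0. lra. }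
  assert (Hg1 : forall y, g (y + 1) = g y + IZR 1).
  { intros y. apply near_identity_injective.
    change (f (g (y + 1)) = f (g y + 1)). rewrite Hf1, !fg. reflexivity. }
  exists (Build_DiffS1 f g (conj Sf (ex_intro _ 1%Z Hf1))
            (conj Sg (ex_intro _ 1%Z Hg1)) fg gf).
  reflexivity.
Qed.

End NearIdentity.

Lemma diffeo_comp (psi phi : DiffS1) : {chi : DiffS1 | forall x, chi x = psi (phi x)}.
Proof.
  assert (M : forall f h, smooth_circle_map f -> smooth_circle_map h ->
    smooth_circle_map (fun x => f (h x))).
  { intros f h [Sf [d Hd]] [Sh [e He]]. split; [apply smooth_comp; auto|].
    (* Removing the linear part of slope [d] leaves a periodic function, so a shift by the integer
       [e] raises [f] by d e: degrees multiply. *)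
    assert (P : periodic (fun x => f x - IZR d * x))
      by (intros x; rewrite Hd; ring).
    exists (d * e)%Z. intros x. rewrite He, mult_IZR.
    assert (E := periodic_IZR _ e (h x) P). simpl in E. lra. }
  unshelve eexists (Build_DiffS1 (fun x => psi (phi x))
    (fun x => lift_inv phi (lift_inv psi x)) _ _ _ _).
  - apply (M psi phi); apply lift_smooth.
  - apply (M (lift_inv phi) (lift_inv psi)); apply lift_inv_smooth.
  - intros x. simpl. rewrite !lift_invK. reflexivity.
  - intros x. simpl. rewrite !liftK. reflexivity.
  - reflexivity.
Qed.

(** Metric compatibility is stated along curves defined at all times. The bounded function t / (1 +
    t^2), with derivative 1 at 0, therefore replaces the parameter t. *)
Lemma perturbation_curve (phi : DiffS1) V : scf V ->
  exists eps c, 0 < eps /\ smooth_curve all_times c /\ c 0 = phi /\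
    forall x, velocity c 0 x = eps * V x.
Proof.
  (* With [W] the translate of [V] to the identity, the perturbation of [phi] is (id + tau eps W) o
     phi. *)
  intros HV. set (W := fun x => V (lift_inv phi x)).
  assert (HW : scf W) by (apply scf_push; auto).
  destruct (scf_bounded (Derive W)) as [M HM]; [apply scf_Derive; auto|].
  assert (HM0 : 0 <= M) by (apply Rle_trans with (2 := HM 0), Rabs_pos).
  (* Makes eps |W'| at most 1; adding 1 to [M] keeps the denominator positive. *)
  set (eps := / (M + 1)).
  assert (Heps : 0 < eps) by (apply Rinv_0_lt_compat; lra).
  set (tau := fun t => t / (1 + t * t)).
  assert (Hden : forall t, 0 < 1 + t * t) by (intros t; nra).
  assert (Htau : forall t, Rabs (tau t) <= 1 / 2).
  { intros t. apply Rabs_le. assert (H := Hden t).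
    assert (H1 := Rle_0_sqr (1 + t)). assert (H2 := Rle_0_sqr (1 - t)).
    unfold Rsqr in H1, H2. unfold tau.
    split; [apply (Rle_div_r _ _ _ H)|apply (Rle_div_l _ _ _ H)]; lra. }
  assert (Hscf : forall t, scf (fun x => tau t * eps * W x))
    by (intros t; apply scf_mult; auto using scf_const).
  assert (Hsmall : forall t x, Rabs (Derive (fun x => tau t * eps * W x) x) <= 1 / 2).
  { intros t x. rewrite Derive_scal, !Rabs_mult, Rmult_assoc, (Rabs_pos_eq eps) by lra.
    assert (E : eps * Rabs (Derive W x) <= 1).
    { apply Rmult_le_reg_l with (M + 1); [lra|]. unfold eps.
      rewrite <- Rmult_assoc, Rinv_r by lra. assert (H := HM x). lra. }
    assert (H1 := Htau t). assert (H2 := Rabs_pos (tau t)).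
    assert (0 <= eps * Rabs (Derive W x))
      by (apply Rmult_le_pos; [lra|apply Rabs_pos]).
    apply Rle_trans with (Rabs (tau t) * 1); [|lra].
    apply Rmult_le_compat_l; auto. }
  set (psi := fun t => near_identity_diffeo _ (Hscf t) (Hsmall t)).
  set (chi := fun t => diffeo_comp (proj1_sig (psi t)) phi).
  (* At time 0 the value is set to [phi] itself: the composite is only known to have the same lift,
     while equality of records is claimed. *)
  set (c := fun t => if Req_EM_T t 0 then phi else proj1_sig (chi t)).
  assert (Ec : forall t x, c t x = phi x + tau t * (eps * V x)).
  { intros t x. unfold c. destruct (Req_EM_T t 0) as [->|].
    - unfold tau. field.
    - rewrite (proj2_sig (chi t)), (proj2_sig (psi t)). unfold W.
      rewrite liftK. ring. }
  exists eps, c. split; [auto|split; [|split]].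
  - apply (js_ext all_times open_all_times
      (fun t x => phi x + tau t * (eps * V x))); [intros; symmetry; apply Ec|].
    assert (O := open_all_times).
    apply js_plus; auto; [apply (js_of_smooth all_times O phi), lift_smooth|].
    apply js_mult; auto.
    + apply (js_div all_times O (fun t _ => t) (fun t _ => 1 + t * t)).
      * intros t _ _. apply Rgt_not_eq, Hden.
      * apply js_fst; auto.
      * apply js_plus; auto; [apply js_const; auto|].
        apply js_mult; auto; apply js_fst; auto.
    + apply js_mult; auto; [apply js_const; auto|].
      apply (js_of_smooth all_times O V), HV.
  - unfold c. destruct (Req_EM_T 0 0); congruence.
  - intros x. unfold velocity.
    rewrite (Derive_ext _ (fun r => phi x + tau r * (eps * V x)))
      by (intros r; apply Ec).
    apply is_derive_unique. unfold tau. auto_derive; [|field].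
    rewrite Rmult_0_l, Rplus_0_r. apply R1_neq_R0.
Qed.

(** * Uniqueness of the Levi-Civita connection *)

Lemma L2_nondegenerate phi A B : scf A -> scf B ->
  (forall Z, scf Z -> right_invariant L2 phi A Z = right_invariant L2 phi B Z) ->
  A = B.
Proof.
  intros HA HB E.
  set (D := fun x => A (lift_inv phi x) - B (lift_inv phi x)).
  assert (HD : scf D) by (apply scf_minus; apply scf_push; auto).
  assert (Z : L2 D D = 0).
  { specialize (E (fun x => A x - B x) (scf_minus _ _ HA HB)).
    unfold right_invariant in E. fold D in E.
    replace D with (fun x => 1 * A (lift_inv phi x) + (-1) * B (lift_inv phi x)) at 1
      by (extensionality x; unfold D; ring).
    rewrite L2_lin_l; [|apply scf_push|apply scf_push|]; auto.
    rewrite E. ring. }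
  extensionality x. destruct (Req_dec (D (phi x)) 0) as [H0|Hn].
  - unfold D in H0. rewrite liftK in H0. lra.
  - assert (P := L2_pos D HD (ex_intro _ (phi x) Hn)). lra.
Qed.

Lemma right_invariant_L2_lin_l phi a b X1 X2 Z : scf X1 -> scf X2 -> scf Z ->
  right_invariant L2 phi (fun x => a * X1 x + b * X2 x) Z =
  a * right_invariant L2 phi X1 Z + b * right_invariant L2 phi X2 Z.
Proof.
  intros H1 H2 HZ.
  apply (L2_lin_l a b (fun x => X1 (lift_inv phi x)) (fun x => X2 (lift_inv phi x)));
    apply scf_push; auto.
Qed.

Lemma right_invariant_L2_sym phi X Z :
  right_invariant L2 phi X Z = right_invariant L2 phi Z X.
Proof. apply L2_sym. Qed.

(** A field constant in time contributes its Christoffel term alone. The zero summand matches the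
    two-term shape of [bilinear] and of the linearity of the metric. *)
Lemma cov_deriv_const Gamma c X eps V : connection Gamma -> scf X -> scf V ->
  (forall x, velocity c 0 x = eps * V x) ->
  cov_deriv Gamma c (fun _ => X) 0 =
  (fun x => eps * Gamma (c 0) V X x + 0 * Gamma (c 0) V X x).
Proof.
  intros [_ [B _]] HX HV Hv. extensionality x. unfold cov_deriv.
  rewrite Derive_const, Rplus_0_l.
  replace (velocity c 0) with (fun y => eps * V y + 0 * V y)
    by (extensionality y; rewrite Hv; ring).
  apply (proj1 (B (c 0) x)); auto.
Qed.

(** Multiplied by [eps], both sides are the derivative at time 0 of the metric on the constant
    fields X and Z along a curve through [phi] with velocity eps V, which involves no connection. *)
Lemma levi_civita_polarization Gamma1 Gamma2 phi V X Z :
  levi_civita (right_invariant L2) Gamma1 ->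
  levi_civita (right_invariant L2) Gamma2 -> scf V -> scf X -> scf Z ->
  right_invariant L2 phi (Gamma1 phi V X) Z +
    right_invariant L2 phi X (Gamma1 phi V Z) =
  right_invariant L2 phi (Gamma2 phi V X) Z +
    right_invariant L2 phi X (Gamma2 phi V Z).
Proof.
  intros LC1 LC2 HV HX HZ.
  destruct (perturbation_curve phi V HV) as (eps & c & Heps & Hc & <- & Hv).
  assert (Hfield : forall Y, scf Y -> smooth_field all_times (fun _ => Y)).
  { intros Y [SY PY]. split; [apply smooth_js|]; auto. }
  assert (D : forall Gamma, levi_civita (right_invariant L2) Gamma ->
    Derive (fun r => right_invariant L2 (c r) X Z) 0 =
      eps * (right_invariant L2 (c 0) (Gamma (c 0) V X) Z +
             right_invariant L2 (c 0) X (Gamma (c 0) V Z))).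
  { intros Gamma (C & _ & M). apply is_derive_unique.
    assert (D := M c (fun _ => X) (fun _ => Z) Hc (Hfield X HX) (Hfield Z HZ) 0).
    rewrite !(cov_deriv_const Gamma c _ eps V C) in D by auto.
    rewrite (right_invariant_L2_sym (c 0) X) in D.
    rewrite !right_invariant_L2_lin_l in D by (auto; apply C; auto).
    rewrite (right_invariant_L2_sym (c 0) X).
    replace (eps * _) with (eps * right_invariant L2 (c 0) (Gamma (c 0) V X) Z +
      0 * right_invariant L2 (c 0) (Gamma (c 0) V X) Z +
      (eps * right_invariant L2 (c 0) (Gamma (c 0) V Z) X +
       0 * right_invariant L2 (c 0) (Gamma (c 0) V Z) X)) by ring.
    exact D. }
  apply Rmult_eq_reg_l with eps; [|lra].
  rewrite <- (D Gamma1 LC1). apply (D Gamma2 LC2).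
Qed.

(* The difference of two Levi-Civita symbols, paired with a third field, is
   symmetric in its first two and antisymmetric in its last two arguments. *)
Lemma levi_civita_unique Gamma1 Gamma2 phi V X :
  levi_civita (right_invariant L2) Gamma1 ->
  levi_civita (right_invariant L2) Gamma2 -> scf V -> scf X ->
  Gamma1 phi V X = Gamma2 phi V X.
Proof.
  intros LC1 LC2 HV HX.
  apply (L2_nondegenerate phi);
    [exact (proj1 (proj1 LC1) phi V X HV HX)|exact (proj1 (proj1 LC2) phi V X HV HX)|].
  intros Z HZ.
  assert (P := fun A B C HA HB HC =>
    levi_civita_polarization Gamma1 Gamma2 phi A B C LC1 LC2 HA HB HC).
  destruct LC1 as (_ & T1 & _). destruct LC2 as (_ & T2 & _).
  assert (S1 : forall A B, scf A -> scf B -> Gamma1 phi A B = Gamma1 phi B A)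
    by (intros; extensionality x; apply T1; auto).
  assert (S2 : forall A B, scf A -> scf B -> Gamma2 phi A B = Gamma2 phi B A)
    by (intros; extensionality x; apply T2; auto).
  (* Koszul's cyclic instances: by symmetry of both symbols, P1 + P2 - P3 retains twice the
     difference paired with Z. *)
  assert (P1 := P V X Z HV HX HZ). assert (P2 := P X Z V HX HZ HV).
  assert (P3 := P Z V X HZ HV HX).
  rewrite (right_invariant_L2_sym phi X) in P1.
  rewrite (right_invariant_L2_sym phi X) in P1.
  rewrite (right_invariant_L2_sym phi Z (Gamma1 _ _ _)),
    (right_invariant_L2_sym phi Z (Gamma2 _ _ _)) in P2.
  rewrite (right_invariant_L2_sym phi V (Gamma1 _ _ _)),
    (right_invariant_L2_sym phi V (Gamma2 _ _ _)) in P3.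
  rewrite (S1 X V), (S2 X V) in P2 by auto.
  rewrite (S1 Z V), (S2 Z V), (S1 Z X), (S2 Z X) in P3 by auto.
  lra.
Qed.

(** * The Lorentz force and the KdV equation *)

Section LorentzForce.

(** The constant [k] is kept apart from the strength, to serve both - a c_GF at strength 1 and c_GF
    at strength - a. *)
Variables (s : (R -> R) -> (R -> R) -> R) (k : R).
Hypothesis Hs : forall u v, s u v = k * gelfand_fuchs u v.

Definition lorentz_KdV (phi : DiffS1) (X : R -> R) (x : R) : R :=
  - k * Derive_n (fun y => X (lift_inv phi y)) 3 (phi x).

Lemma lorentz_KdV_scf phi X : scf X -> scf (lorentz_KdV phi X).
Proof.
  intros HX. apply scf_mult; [apply scf_const|].
  apply (scf_pull (Derive_n (fun y => X (lift_inv phi y)) 3)).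
  apply scf_Derive_n, scf_push, HX.
Qed.

Lemma lorentz_KdV_correct :
  lorentz_force (right_invariant L2) (right_invariant s) lorentz_KdV.
Proof.
  intros phi X HX. split; [apply lorentz_KdV_scf, HX|]. intros Z HZ.
  unfold right_invariant. rewrite Hs, gelfand_fuchs_L2 by (apply scf_push; auto).
  set (U := Derive_n (fun x => X (lift_inv phi x)) 3).
  assert (HU : scf U) by (apply scf_Derive_n, scf_push; auto).
  replace (fun x => lorentz_KdV phi X (lift_inv phi x))
    with (fun x => - k * U x + 0 * U x)
    by (extensionality x; unfold lorentz_KdV; rewrite lift_invK; unfold U; ring).
  rewrite L2_lin_l; auto; [ring|]. apply scf_push; auto.
Qed.

Lemma lorentz_force_unique Y phi X : scf X ->
  lorentz_force (right_invariant L2) (right_invariant s) Y ->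
  Y phi X = lorentz_KdV phi X.
Proof.
  intros HX HY. destruct (HY phi X HX) as [SY EY].
  apply (L2_nondegenerate phi); auto using lorentz_KdV_scf.
  intros Z HZ. rewrite EY by auto. symmetry. apply lorentz_KdV_correct; auto.
Qed.

(** By uniqueness, the existentially quantified connection and force agree with the explicit ones on
    the velocity, which is a circle function at each time in I. *)
Lemma magnetic_geodesic_iff strength T gamma :
  near_I T (fun J => smooth_curve J gamma) ->
  (magnetic_geodesic L2 s strength T gamma <->
   forall t x, in_I T t ->
     cov_deriv Gamma_L2 gamma (velocity gamma) t x =
     strength * lorentz_KdV (gamma t) (velocity gamma t) x).
Proof.
  intros Hn. assert (Hn0 := Hn). destruct Hn0 as (d & Hd & Hc).
  set (J := fun t => - d < t /\ Rbar_lt t T) in Hc.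
  assert (HJ : open J) by (apply open_and; [apply open_gt|apply open_Rbar_lt]).
  assert (HV : forall t, in_I T t -> scf (velocity gamma t)).
  { intros t [Ht0 HtT]. apply (scf_field J).
    - apply field_velocity; auto.
    - split; [lra|exact HtT]. }
  split.
  - intros (_ & Gamma & Y & HG & HY & E) t x Ht. specialize (E t x Ht).
    unfold cov_deriv in *.
    rewrite (levi_civita_unique Gamma Gamma_L2) in E
      by auto using Gamma_L2_levi_civita.
    rewrite (lorentz_force_unique Y) in E by auto. exact E.
  - intros E. split; [exact Hn|]. exists Gamma_L2, lorentz_KdV.
    auto using Gamma_L2_levi_civita, lorentz_KdV_correct.
Qed.

(** The chain rule for V = u o gamma turns the geodesic equation at y into the evolution equation at
    gamma_t(y), and gamma_t is a bijection. *)
Lemma magnetic_geodesic_KdV strength T gamma :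
  near_I T (fun J => smooth_curve J gamma) ->
  (magnetic_geodesic L2 s strength T gamma <->
   evolution_solution (KdV (- (strength * k))) T (eulerian_velocity gamma)).
Proof.
  intros Hn. rewrite magnetic_geodesic_iff by exact Hn.
  destruct Hn as (d & Hd & Hc).
  set (J := fun t => - d < t /\ Rbar_lt t T) in Hc.
  assert (HJ : open J) by (apply open_and; [apply open_gt|apply open_Rbar_lt]).
  assert (HI : forall t, in_I T t -> J t)
    by (intros t [Ht0 HtT]; split; [lra|exact HtT]).
  set (V := velocity gamma). set (u := eulerian_velocity gamma).
  assert (HV : smooth_field J V) by (apply field_velocity; auto).
  assert (Hu : smooth_field J u) by (apply (field_push J HJ gamma Hc V HV)).
  assert (EV : forall t y, V t y = u t (gamma t y)).
  { intros t y. unfold u, eulerian_velocity. rewrite liftK. reflexivity. }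
  destruct (js_derivatives J _ Hc) as [Dt Dx].
  assert (EVt : forall t y, J t ->
    dt V t y = dt u t (gamma t y) + dx u t (gamma t y) * V t y).
  { intros t y Ht. apply is_derive_unique.
    apply (is_derive_ext (fun r => u r (gamma r y))).
    - intros r. symmetry. apply EV.
    - apply (chain_t J HJ u (fun r y => gamma r y)); [apply Hu|auto|].
      apply Dt; auto. }
  assert (EVx : forall t y, J t ->
    Derive (V t) y = dx u t (gamma t y) * Derive (gamma t) y).
  { intros t y Ht. apply is_derive_unique.
    apply (is_derive_ext (fun z => u t (gamma t z))).
    - intros z. symmetry. apply EV.
    - apply (chain_x J u (fun r y => gamma r y)); [apply Hu|auto|].
      apply Dx; auto. }
  (* One u u_x is the transport term in V_t; the other two come from (V^2)' / gamma' = (u^2)_x o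
     gamma. *)
  assert (Ecov : forall t y, J t -> cov_deriv Gamma_L2 gamma V t y =
    dt u t (gamma t y) + 3 * u t (gamma t y) * dx u t (gamma t y)).
  { intros t y Ht. unfold cov_deriv, Gamma_L2.
    change (Derive (fun r => V r y) t) with (dt V t y). fold V.
    rewrite EVt, EVx, EV by auto. field. apply lift_immersion. }
  split.
  - intros E. split; [exists d; auto|]. intros t x Ht.
    specialize (E t (lift_inv (gamma t) x) Ht).
    rewrite Ecov in E by auto. unfold lorentz_KdV in E.
    rewrite lift_invK in E. unfold KdV.
    change (Derive (fun r => u r x) t) with (dt u t x).
    change (Derive (u t) x) with (dx u t x).
    change (fun y => V t (lift_inv (gamma t) y)) with (u t) in E. lra.
  - intros [_ E] t x Ht. rewrite Ecov by auto. unfold lorentz_KdV.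
    change (fun y => V t (lift_inv (gamma t) y)) with (u t).
    specialize (E t (gamma t x) Ht). unfold KdV in E.
    change (Derive (fun r => u r (gamma t x)) t) with (dt u t (gamma t x)) in E.
    change (Derive (u t) (gamma t x)) with (dx u t (gamma t x)) in E. lra.
Qed.

End LorentzForce.

(** With the convention G(Y u, v) = sigma(u, v) and c_GF(u, v) = int u v_xxx,
    integration by parts gives Y u = - u_xxx for the Lorentz force of c_GF, so
    that + a u_xxx in the KdV equation corresponds to the form - a c_GF. *)
Theorem corollary4p4 (a : R) :
  magnetic_euler_arnold L2 (fun u v => - a * gelfand_fuchs u v) (KdV a) /\
  (forall (T : Rbar) (gamma : R -> DiffS1),
     Rbar_lt 0 T -> near_I T (fun J => smooth_curve J gamma) ->
     (magnetic_geodesic L2 gelfand_fuchs (- a) T gamma <->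
      evolution_solution (KdV a) T (eulerian_velocity gamma))).
Proof.
  split; [split|].
  - split; [exact L2_inner_product|apply gelfand_fuchs_two_cocycle].
  - intros T gamma _ Hn. replace (KdV a) with (KdV (- (1 * - a))) by (f_equal; ring).
    apply magnetic_geodesic_KdV; auto.
  - intros T gamma _ Hn. replace (KdV a) with (KdV (- (- a * 1))) by (f_equal; ring).
    apply magnetic_geodesic_KdV; auto. intros u v. ring.
Qed.
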